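(* Let $d\ge 2$, let $S\subset \mathrm{Sl}(d,\mathbb{R})$ be a connected semigroup with nonempty interior in $\mathrm{Sl}(d,\mathbb{R})$, let $\Theta(S)\subset\{1,\ldots,d-1\}$ be its flag type, and let $k\in\{1,\ldots,d-1\}$. If $k\in\Theta(S)$, then there exists an $S$-invariant cone $\{0\}\neq W\subset\bigwedge^k\mathbb{R}^d$.
   Context: A cone in a finite-dimensional real vector space $V$ means a closed convex cone $W\subset V$ that is proper ($W\neq V$) and non-trivial ($W\neq\{0\}$). $\mathrm{Sl}(d,\mathbb{R})$ acts linearly on $\bigwedge^k\mathbb{R}^d$ by $g(u_1\wedge\cdots\wedge u_k)=gu_1\wedge\cdots\wedge gu_k$; a set $W$ is $S$-invariant if $gW\subset W$ for all $g\in S$. Flag type. Let $\Theta_M=\{1,\ldots,d-1\}$. For $\Theta=\{r_1<\cdots<r_n\}\subset\Theta_M$ let $\mathbb{F}_\Theta$ be the flag manifold of all flags $(V_1\subset\cdots\subset V_n)$ of subspaces of $\mathbb{R}^d$ with $\dim V_i=r_i$ (for $\Theta=\emptyset$, $\mathbb{F}_\Theta$ is a point), with the natural action of $\mathrm{Sl}(d,\mathbb{R})$; write $\mathbb{F}=\mathbb{F}_{\Theta_M}$ and let $\pi_\Theta:\mathbb{F}\to\mathbb{F}_\Theta$ be the canonical projection. An invariant control set of $S$ in $\mathbb{F}_\Theta$ is a subset $D\subset\mathbb{F}_\Theta$ such that $\mathrm{cl}(Sx)=D$ for all $x\in D$ and $D$ is maximal with this property. It is known that for a semigroup $S$ with nonempty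 interior there is exactly one invariant control set $C_\Theta$ in each $\mathbb{F}_\Theta$ (write $C$ for the one in $\mathbb{F}$), and that among the sets $\Theta\subset\Theta_M$ with $\pi_\Theta^{-1}(C_\Theta)=C$ there is exactly one minimal one; it is denoted $\Theta(S)$ and called the flag type of $S$. *)

(* Defs.v *)
From HB Require Import structures.
From mathcomp Require Import all_boot all_order all_algebra perm.
From mathcomp Require Import all_classical all_reals all_analysis.
Import Order.TTheory GRing.Theory Num.Theory numFieldNormedType.Exports.

Set Implicit Arguments.
Unset Strict Implicit.
Unset Printing Implicit Defensive.

Local Open Scope classical_set_scope.
Local Open Scope ring_scope.

(* Sl(d, R), with the topology induced by 'M[R]_d. *)
Record SL (R : realType) (d : nat) :=
  MkSL { slval :> 'M[R]_d ; _ : \det slval == 1 }.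

HB.instance Definition _ R d := [isSub for @slval R d].
HB.instance Definition _ R d := [Choice of SL R d by <:].

Section SLgroup.
Context {R : realType} {d : nat}.
Implicit Types g h : SL R d.

Lemma SL_det g : \det (slval g) = 1.
Proof. by case: g => M /= /eqP. Qed.

Lemma SL_unitmx g : slval g \in unitmx.
Proof. by rewrite unitmxE SL_det unitr1. Qed.

Fact slmul_subproof g h : \det (slval g *m slval h) == 1.
Proof. by rewrite det_mulmx !SL_det mulr1. Qed.
Definition slmul g h : SL R d := MkSL (slmul_subproof g h).

Fact slone_subproof : \det (1%:M : 'M[R]_d) == 1.
Proof. by rewrite det1. Qed.
Definition slone : SL R d := MkSL slone_subproof.

Fact slinv_subproof g : \det (invmx (slval g)) == 1.
Proof. by rewrite det_inv SL_det invr1. Qed.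
Definition slinv g : SL R d := MkSL (slinv_subproof g).

Fact slmulA : associative slmul.
Proof. by move=> g h k; apply: val_inj; rewrite /= mulmxA. Qed.
Fact slmul1g : left_id slone slmul.
Proof. by move=> g; apply: val_inj; rewrite /= mul1mx. Qed.
Fact slmulg1 : right_id slone slmul.
Proof. by move=> g; apply: val_inj; rewrite /= mulmx1. Qed.
Fact slmulVg : left_inverse slone slinv slmul.
Proof. by move=> g; apply: val_inj; rewrite /= mulVmx ?SL_unitmx. Qed.
Fact slmulgV : right_inverse slone slinv slmul.
Proof. by move=> g; apply: val_inj; rewrite /= mulmxV ?SL_unitmx. Qed.
End SLgroup.

HB.instance Definition _ R d := isGroup.Build (SL R d)
  (@slmulA R d) (@slmul1g R d) (@slmulg1 R d) (@slmulVg R d) (@slmulgV R d).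
HB.instance Definition _ R d :=
  Topological.copy (SL R d) (initial_topology (@slval R d)).

Definition is_semigroup (R : realType) (d : nat) (S : set (SL R d)) : Prop :=
  forall g h, S g -> S h -> S (g * h)%g.

(* Theta_M = {1, ..., d - 1}. *)
Definition ThetaM (d : nat) : Type := {r : 'I_d | (0 < r)%N}.

HB.instance Definition _ (d : nat) := SubFinite.on (ThetaM d).

Coercion rk (d : nat) (r : ThetaM d) : nat := val (val r).

Definition is_flag (R : realType) (d : nat) (Th : {set ThetaM d})
    (V : {ffun {r | r \in Th} -> {vspace 'cV[R]_d}}) : bool :=
  [forall r, \dim (V r) == rk (val r)] &&
  [forall r, forall s, (rk (val r) <= rk (val s))%N ==> (V r <= V s)%VS].

Record flag (R : realType) (d : nat) (Th : {set ThetaM d}) := Flag {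
  flag_fun :> {ffun {r | r \in Th} -> {vspace 'cV[R]_d}} ;
  _ : is_flag flag_fun }.

HB.instance Definition _ (R : realType) (d : nat) (Th : {set ThetaM d}) :=
  [isSub for @flag_fun R d Th].
HB.instance Definition _ (R : realType) (d : nat) (Th : {set ThetaM d}) :=
  [Choice of flag R Th by <:].

Section FlagAction.
Context {R : realType} {d : nat} {Th : {set ThetaM d}}.

Fact flag_act_subproof (g : SL R d) (V : flag R Th) :
  is_flag [ffun r => (linfun (mulmx (slval g)) @: V r)%VS
          : {vspace 'cV[R]_d}].
Proof.
have /andP[/forallP dV /forallP sV] : is_flag V by case: V.
apply/andP; split; apply/forallP => r.
  rewrite ffunE limg_dim_eq ?dV //; apply/eqP.
  suff -> : lker (linfun (mulmx (slval g))) = 0%VS :> {vspace 'cV[R]_d}.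
    by rewrite capv0.
  apply/eqP/lker0P => x y; rewrite !lfunE /= => /(congr1 (mulmx (invmx g))).
  by rewrite !mulKmx ?SL_unitmx.
apply/forallP => s; apply/implyP => rs; rewrite !ffunE limgS //.
by have /forallP/(_ s)/implyP := sV r; apply.
Qed.

Definition flag_act (g : SL R d) (V : flag R Th) : flag R Th :=
  Flag (flag_act_subproof g V).

(* The manifold topology of F_Th = Sl(d, R) / P_Th: the finest topology making
   all orbit maps g |-> g V continuous. As Sl(d, R) acts transitively and right
   translations are homeomorphisms, this is the quotient topology given by any
   single orbit map. *)
Definition flag_open (U : set (flag R Th)) : Prop :=
  forall V : flag R Th, open [set g : SL R d | U (flag_act g V)].

Fact flag_openT : flag_open [set: flag R Th].
Proof. by move=> V; exact: openT. Qed.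
Fact flag_openI : setI_closed flag_open.
Proof. by move=> U U' oU oU' V; exact: (openI (oU V) (oU' V)). Qed.
Fact flag_open_bigU (I : Type) (U : I -> set (flag R Th)) :
  (forall i, flag_open (U i)) -> flag_open (\bigcup_i U i).
Proof.
move=> oU V.
rewrite (_ : [set _ | _] = \bigcup_i [set g : SL R d | U i (flag_act g V)]) //.
by apply: bigcup_open => i _; exact: oU.
Qed.
End FlagAction.

HB.instance Definition _ (R : realType) (d : nat) (Th : {set ThetaM d}) :=
  isOpenTopological.Build (@flag R d Th)
  (@flag_openT R d Th) (@flag_openI R d Th) (@flag_open_bigU R d Th).

Section FlagProj.
Context {R : realType} {d : nat}.

Fact flag_proj_subproof (Th : {set ThetaM d}) (V : flag R [set: ThetaM d]%SET) :
  is_flag [ffun r : {r | r \in Th} =>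
             V (exist _ (val r) (finset.in_setT (val r))) : {vspace 'cV[R]_d}].
Proof.
have /andP[/forallP dV /forallP sV] : is_flag V by case: V.
apply/andP; split; apply/forallP => r; first by rewrite ffunE dV.
apply/forallP => s; rewrite !ffunE.
have /forallP := sV (exist _ (val r) (finset.in_setT (val r))).
by move=> /(_ (exist _ (val s) (finset.in_setT (val s)))).
Qed.

Definition flag_proj (Th : {set ThetaM d}) (V : flag R [set: ThetaM d]%SET) :
  flag R Th := Flag (flag_proj_subproof Th V).
End FlagProj.
Arguments flag_proj {R d} Th V.

Section FlagType.
Context {R : realType} {d : nat} (S : set (SL R d)).

Definition control_property (Th : {set ThetaM d}) (D : set (flag R Th)) :=
  forall V, D V -> closure [set flag_act g V | g in S] = D.

Definition is_invariant_control_set (Th : {set ThetaM d})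
    (D : set (flag R Th)) : Prop :=
  control_property D /\
  forall D', control_property D' -> D `<=` D' -> D' = D.

(* C_Th; the default value is irrelevant, as for S with nonempty interior there
   is exactly one invariant control set. *)
Definition invariant_control_set (Th : {set ThetaM d}) : set (flag R Th) :=
  xget set0 [set D | is_invariant_control_set D].
Arguments invariant_control_set Th : clear implicits.

Definition is_flag_type (Th : {set ThetaM d}) : Prop :=
  minset (fun Th' : {set ThetaM d} =>
    `[< flag_proj Th' @^-1` invariant_control_set Th' =
        invariant_control_set [set: ThetaM d]%SET >]) Th.

(* Theta(S); such a minimal set always exists, and is unique for S with nonempty
   interior. *)
Definition flag_type : {set ThetaM d} :=
  xget [set: ThetaM d]%SET [set Th | is_flag_type Th].
End FlagType.

(* The exterior power of R^d in coordinates: the increasing k-tuples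
   B = (b_1 < ... < b_k) index the basis e_{b_1} /\ ... /\ e_{b_k}, and the
   coordinates of u_1 /\ ... /\ u_k are the k x k minors of (u_1 | ... | u_k). *)
Definition incr (d k : nat) : finType :=
  {t : k.-tuple 'I_d | sorted ltn (map val t)}.

Notation ext R d k := 'cV[R]_#|{: incr d k}|.

Definition incr_val (d k : nat) (a : 'I_#|{: incr d k}|) : 'I_k -> 'I_d :=
  tnth (val (enum_val a)).

Definition wedge (R : realType) (d k : nat) (U : 'M[R]_(d, k)) : ext R d k :=
  \col_a \det (rowsub (incr_val a) U).

(* The matrix of the action of g; column b is g e_{b_1} /\ ... /\ g e_{b_k}. *)
Definition ext_mx (R : realType) (d k : nat) (g : 'M[R]_d) :
    'M[R]_#|{: incr d k}| :=
  \matrix_(a, b) \det (mxsub (incr_val a) (incr_val b) g).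

Lemma incr_val_inj (d k : nat) (a : 'I_#|{: incr d k}|) :
  injective (incr_val a).
Proof.
rewrite /incr_val; case: (enum_val a) => t /= st; apply/tuple_uniqP.
rewrite -(map_inj_uniq val_inj).
exact: (sorted_uniq ltn_trans ltnn).
Qed.

Definition incr_perm (d k : nat) (p : 'I_#|{: incr d k}| * 'S_k) :
  {ffun 'I_k -> 'I_d} := [ffun i => incr_val p.1 (p.2 i)].

Lemma incr_perm_inj (d k : nat) : injective (@incr_perm d k).
Proof.
move=> [a s] [b t] /ffunP /= e.
have e' i : incr_val a (s i) = incr_val b (t i) by have := e i; rewrite !ffunE.
have eab : a = b.
  apply/enum_val_inj/val_inj/val_inj/(inj_map val_inj).
  apply: (irr_sorted_eq ltn_trans ltnn);
    [exact: (valP (enum_val a))|exact: (valP (enum_val b))|].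
  have sub (f f' : 'I_k -> 'I_d) (s1 s2 : 'S_k) :
      (forall i, f (s1 i) = f' (s2 i)) -> forall i, exists j, f i = f' j.
    by move=> ff i; exists (s2 ((s1^-1)%g i)); rewrite -ff permKV.
  move=> x; apply/mapP/mapP => -[y /tnthP[i ->] ->].
    have [j ej] := sub _ _ _ _ e' i; exists (incr_val b j); rewrite ?mem_tnth //.
    by rewrite -ej.
  have [j ej] := sub _ _ _ _ (fun i => esym (e' i)) i.
  by exists (incr_val a j); rewrite ?mem_tnth // -ej.
subst b; congr pair; apply/permP => i; exact: (incr_val_inj (e' i)).
Qed.

Lemma incr_perm_img (d k : nat) :
  [set incr_perm p | p in {: 'I_#|{: incr d k}| * 'S_k}]%SET =
  [set f : {ffun 'I_k -> 'I_d} | injectiveb f]%SET.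
Proof.
apply/eqP; rewrite eqEcard; apply/andP; split.
  apply/fintype.subsetP => f /imsetP[[a s] _ ->]; rewrite inE; apply/injectiveP.
  by move=> i j; rewrite !ffunE => /incr_val_inj /perm_inj.
rewrite card_imset; last exact: incr_perm_inj.
rewrite card_inj_ffuns card_prod !card_ord card_Sn -bin_ffact.
rewrite card_sub -(card_ltn_sorted_tuples k d) leq_mul2r; apply/orP; right.
by rewrite cardsE.
Qed.

(* Cauchy-Binet: g (u_1 /\ ... /\ u_k) = g u_1 /\ ... /\ g u_k. *)
Lemma ext_mx_wedge (R : realType) (d k : nat) (g : 'M[R]_d) (U : 'M[R]_(d, k)) :
  ext_mx k g *m wedge U = wedge (g *m U).
Proof.
apply/colP => a; rewrite !mxE.
have -> : rowsub (incr_val a) (g *m U) = rowsub (incr_val a) g *m U.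
  by apply/matrixP => i j; rewrite !mxE; apply: eq_bigr => l _; rewrite !mxE.
set G := rowsub (incr_val a) g.
transitivity (\sum_(f : {ffun 'I_k -> 'I_d})
    (\prod_i G i (f i)) * \det (rowsub f U)); last first.
  rewrite [RHS]/determinant.
  under [RHS]eq_bigr => s _.
    under eq_bigr => i _ do rewrite mxE.
    rewrite bigA_distr_bigA /= big_distrr /=.
    over.
  rewrite exchange_big /=; apply: eq_bigr => f _.
  rewrite /determinant big_distrr /=; apply: eq_bigr => s _.
  rewrite big_split /= mulrCA; congr (_ * (_ * _)).
  by apply: eq_bigr => i _; rewrite mxE.
rewrite (bigID (fun f : {ffun 'I_k -> 'I_d} => injectiveb f)) /=.
rewrite [X in _ + X]big1 ?addr0.
  rewrite (eq_bigl (mem [set f : {ffun 'I_k -> 'I_d} | injectiveb f]%SET)) /=;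
    last by move=> f; rewrite /= inE.
  rewrite -incr_perm_img big_imset /=;
    last by move=> ? ? _ _; exact: incr_perm_inj.
  rewrite -(pair_bigA _ (fun b s => \prod_i G i (incr_perm (b, s) i) *
     \det (rowsub (incr_perm (b, s)) U))) /=.
  apply: eq_bigr => b _; rewrite !mxE [X in X * _]/determinant big_distrl /=.
  apply: eq_bigr => s _.
  have -> : rowsub (incr_perm (b, s)) U = row_perm s (rowsub (incr_val b) U).
    by apply/matrixP => i j; rewrite !mxE ffunE.
  rewrite row_permE det_mulmx det_perm mulrCA mulrA; congr (_ * _ * _).
  by apply: eq_bigr => i _; rewrite !mxE ffunE.
move=> f /injectivePn[i [j ij fij]].
by rewrite (determinant_alternate ij) ?mulr0 // => l; rewrite !mxE fij.
Qed.

Definition is_cone (R : realType) (n : nat) (W : set 'cV[R]_n) : Prop :=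
  [/\ closed W, convex_set W, W 0,
      forall (t : R) x, 0 <= t -> W x -> W (t *: x)
    & W <> setT /\ W <> [set 0]].

Definition ext_invariant (R : realType) (d k : nat) (S : set (SL R d))
    (W : set (ext R d k)) : Prop :=
  forall g, S g -> [set ext_mx k g *m x | x in W] `<=` W.

(* Main.v *)
Require Import Defs.
From mathcomp Require Import all_boot all_order all_algebra perm complex.
From mathcomp Require Import all_classical all_reals all_analysis.
From mathcomp Require Import ring lra zify.
Import Order.TTheory GRing.Theory Num.Theory numFieldNormedType.Exports.

(* The theorem is reduced to the following: if for all k-planes V and all
   (d - k)-planes U some g in S makes g V meet U, then k can be removed from
   any set Th with pi_Th^-1 (C_Th) = C. Otherwise, for some V and U, the
   functional on the exterior power given by U does not vanish on S v, where v
   spans the line of V; by connectedness it has constant sign there, and the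
   closed convex cone generated by the vectors g v (up to that sign) is proper.

   S contains a matrix h with real eigenvalues of distinct moduli: some power
   of a perturbation of any matrix is triangularizable over R, as the
   arguments of the complex eigenvalues can be made rational multiples of pi.
   Let b be the flag of eigenspaces of h attracting almost all flags. Then
   every invariant control set is the closure of the orbit of b, and
   pi_Th^-1 (C_Th) = C means that the set of X with X b0 in C (b0 the standard
   flag) is stable by right translations by the parabolic subgroup P_Th.

   If all V and U as above meet after a translation in S, a flag of S b in the
   codimension one Bruhat cell attached to k is interior to S b, up to a
   perturbation. The powers of h expand a transverse curve through it to the
   fiber of b for the projection forgetting the k-th subspace. Hence C is
   stable by the parabolic subgroup of {1, ..., d - 1} \ {k}, which together
   with P_Th generates the parabolic subgroup of Th \ {k}. *)

Set Implicit Arguments.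
Unset Strict Implicit.
Unset Printing Implicit Defensive.

Local Open Scope classical_set_scope.
Local Open Scope ring_scope.

(** * Convergence of matrices *)

Section Topology.
Context {R : realType}.

Lemma cvg_mxP (T : Type) (F : set_system T) (FF : Filter F) m n
    (f : T -> 'M[R]_(m, n)) (A : 'M[R]_(m, n)) :
  (f @ F --> A) <-> (forall i j, (fun t => f t i j) @ F --> A i j).
Proof.
split=> [fA i j|fA P /nbhs_ballP[e /= e0 sP]].
  exact: (@continuous_cvg _ _ _ F FF f (fun M : 'M[R]_(m, n) => M i j) A
    (@coord_continuous R m n i j A)).
have : \forall t \near F, forall i j, ball (A i j) e (f t i j).
  apply: filter_forall => i; apply: filter_forall => j; apply: (fA i j).
  exact: nbhsx_ballx.
by apply: filterS => t At; apply: sP; split.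
Qed.

Lemma cvg_bigsum (T I : Type) (F : set_system T) (FF : Filter F) (r : seq I)
    (P : pred I) (f : I -> T -> R) (a : I -> R) :
  (forall i, P i -> f i @ F --> a i) ->
  (fun t => \sum_(i <- r | P i) f i t) @ F --> \sum_(i <- r | P i) a i.
Proof. by move=> fa; apply: cvg_big => //; exact: add_continuous. Qed.

Lemma cvg_bigprod (T I : Type) (F : set_system T) (FF : Filter F) (r : seq I)
    (P : pred I) (f : I -> T -> R) (a : I -> R) :
  (forall i, P i -> f i @ F --> a i) ->
  (fun t => \prod_(i <- r | P i) f i t) @ F --> \prod_(i <- r | P i) a i.
Proof. by move=> fa; apply: cvg_big => //; exact: mul_continuous. Qed.

Lemma cvg_mulmx (T : Type) (F : set_system T) (FF : Filter F) m n p
    (f : T -> 'M[R]_(m, n)) (g : T -> 'M[R]_(n, p)) (A : 'M[R]_(m, n)) (B : 'M[R]_(n, p)) :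
  f @ F --> A -> g @ F --> B -> (fun t => f t *m g t) @ F --> A *m B.
Proof.
move=> /cvg_mxP fA /cvg_mxP gB; apply/cvg_mxP => i j.
rewrite [X in X @ _ --> _](_ : _ = fun t => \sum_k f t i k * g t k j); last first.
  by apply/funext => t; rewrite mxE.
by rewrite mxE; apply: cvg_bigsum => k _; apply: cvgM.
Qed.

Lemma cvg_det (T : Type) (F : set_system T) (FF : Filter F) n
    (f : T -> 'M[R]_n) (A : 'M[R]_n) :
  f @ F --> A -> (fun t => \det (f t)) @ F --> \det A.
Proof.
move=> /cvg_mxP fA; rewrite /determinant; apply: cvg_bigsum => s _.
apply: cvgM; first exact: cvg_cst.
by apply: cvg_bigprod => i _; exact: fA.
Qed.

Lemma cvg_addmx (T : Type) (F : set_system T) (FF : Filter F) m n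
    (f g : T -> 'M[R]_(m, n)) (A B : 'M[R]_(m, n)) :
  f @ F --> A -> g @ F --> B -> (fun t => f t + g t) @ F --> A + B.
Proof.
move=> /cvg_mxP fA /cvg_mxP gB; apply/cvg_mxP => i j; rewrite mxE.
under eq_cvg do rewrite mxE; exact: cvgD.
Qed.

Lemma cvg_scalemx (T : Type) (F : set_system T) (FF : Filter F) m n
    (f : T -> R) (a : R) (A : 'M[R]_(m, n)) :
  f @ F --> a -> (fun t => f t *: A) @ F --> a *: A.
Proof.
move=> fa; apply/cvg_mxP => i j; rewrite mxE.
under eq_cvg do rewrite mxE; exact: cvgMl.
Qed.

Lemma cvg_SL (T : Type) (F : set_system T) (FF : Filter F) d
    (f : T -> SL R d) (g : SL R d) :
  (fun t => slval (f t)) @ F --> slval g -> f @ F --> g.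
Proof.
move=> fg A; rewrite nbhsE => -[B [[C oC <-] Bg] BA].
have : \forall t \near F, C (slval (f t)) by apply: fg; exact: open_nbhs_nbhs.
by apply: filterS => t Ct; apply: BA.
Qed.

Lemma slval_continuous d : continuous (@slval R d).
Proof. exact: initial_continuous. Qed.

Lemma cvg_slmul (T : Type) (F : set_system T) (FF : Filter F) d
    (f g : T -> SL R d) (a b : SL R d) :
  f @ F --> a -> g @ F --> b -> (fun t => (f t * g t)%g) @ F --> (a * b)%g.
Proof.
move=> fa gb; apply: cvg_SL; apply: cvg_mulmx.
  exact: (@continuous_cvg _ _ _ F FF f (@slval R d) a (@slval_continuous d a) fa).
exact: (@continuous_cvg _ _ _ F FF g (@slval R d) b (@slval_continuous d b) gb).
Qed.

(** Once the root [a] is factored out with its multiplicity, the cofactor does not vanish at [a],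
    hence not near [a] by continuity. *)
Lemma near_horner_neq0 (p : {poly R}) (a : R) :
  p != 0 -> \forall t \near a^', p.[t] != 0.
Proof.
move=> p0; have [m [q]] := multiplicity_XsubC p a; rewrite p0 /= => qa ->.
have qc : continuous (horner q).
  move=> x; rewrite /continuous_at horner_coef.
  rewrite [X in X @ _ --> _](_ : _ = fun t => \sum_(i < size q) q`_i * t ^+ i).
    by apply: cvg_bigsum => i _; apply: cvgM; [exact: cvg_cst|exact: exprn_continuous].
  by apply/funext => t; rewrite horner_coef.
have nq : nbhs q.[a] [set x | x != 0].
  by apply: open_nbhs_nbhs; split=> //; exact: open_neq.
have qn := nbhs_dnbhs (qc a _ nq).
near=> t.
rewrite hornerM horner_exp !hornerE mulf_neq0 ?expf_neq0 ?subr_eq0 //.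
  by near: t.
by near: t; exact: nbhs_dnbhs_neq.
Unshelve. all: by end_near. Qed.

(** The excluded [t] are eigenvalues of [- M], that is, roots of a monic polynomial. *)
Lemma near_det_neq0 n (M : 'M[R]_n) :
  \forall t \near (0 : R)^', \det (M + t%:M) != 0.
Proof.
have := near_horner_neq0 0 (monic_neq0 (char_poly_monic (- M))).
apply: filterS => t; rewrite -rootE -eigenvalue_root_char => H.
apply: contra H => /eqP H; apply/eigenvalueP.
have /eqP/det0P[v v0 vM] := H; exists v => //.
move: vM; rewrite mulmxDr mul_mx_scalar => /eqP.
by rewrite addr_eq0 mulmxN => /eqP ->; rewrite opprK.
Qed.
End Topology.

(** * Triangular matrices *)

Section Triangular.
Context {R : realType}.

Definition unitlower n (L : 'M[R]_n) : Prop :=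
  forall i j : 'I_n, (i <= j)%N -> L i j = (i == j)%:R.

Definition upper n (U : 'M[R]_n) : Prop :=
  forall i j : 'I_n, (j < i)%N -> U i j = 0.

Lemma unitlower_det n (L : 'M[R]_n) : unitlower L -> \det L = 1.
Proof.
move=> lL; rewrite det_trig; last first.
  by apply/is_trig_mxP => i j ij; rewrite lL ?(ltnW ij) // -val_eqE /= ltn_eqF.
by rewrite big1 // => i _; rewrite lL // eqxx.
Qed.

Lemma upper_det n (U : 'M[R]_n) : upper U -> \det U = \prod_i U i i.
Proof.
move=> uU; rewrite -det_tr det_trig; first by apply: eq_bigr => i _; rewrite mxE.
by apply/is_trig_mxP => i j ij; rewrite mxE uU.
Qed.

Lemma upperM n (U V : 'M[R]_n) : upper U -> upper V -> upper (U *m V).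
Proof.
move=> uU uV i j ji; rewrite mxE big1 // => k _.
have [ik|ki] := leqP i k; first by rewrite uV ?mulr0 // (leq_trans ji).
by rewrite uU ?mul0r.
Qed.

(** Induction on the size by bordering: for small nonzero [t] the upper left block is factorized and
    invertible, and its Schur complement is the last diagonal entry of [U]. *)
Lemma near_LU n (M : 'M[R]_n) : \forall t \near (0 : R)^',
  exists L U, [/\ M + t%:M = L *m U, unitlower L & upper U].
Proof.
elim: n M => [|n IHn] M.
  by apply: nearW => t; exists 1%:M, 1%:M; split; [rewrite [LHS]flatmx0 [RHS]flatmx0|case|case].
move: M; rewrite -addn1 => M.
have nA := IHn (ulsubmx M); have nD := near_det_neq0 (ulsubmx M).
near=> t.
have [L [U [eLU lL uU]]] :
    exists L U, [/\ ulsubmx M + t%:M = L *m U, unitlower L & upper U].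
  by near: t.
have /eqP dLU : \det (ulsubmx M + t%:M) != 0 by near: t.
have Lu : L \in unitmx by rewrite unitmxE unitlower_det ?unitr1.
have Uu : U \in unitmx.
  rewrite unitmxE unitfE; apply/eqP => U0.
  by apply: dLU; rewrite eLU det_mulmx U0 mulr0.
pose c := ursubmx M; pose r := dlsubmx M.
exists (block_mx L 0 (r *m invmx U) 1%:M),
  (block_mx U (invmx L *m c) 0 (drsubmx M + t%:M - r *m invmx U *m (invmx L *m c))).
split.
- rewrite mulmx_block !mulmx0 !mul0mx !addr0 !mul1mx mulKVmx // mulmxKV //.
  rewrite [X in block_mx _ _ _ X]addrC subrK -eLU.
  by rewrite -{1}(submxK M) (scalar_mx_block n 1 t) add_block_mx !addr0.
- move=> i j; case: (split_ordP i) => i' ->; case: (split_ordP j) => j' ->.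
  + by rewrite block_mxEul /= => ij; rewrite lL.
  + by rewrite block_mxEur mxE eq_lrshift.
  + move=> /= ij; have := leq_ltn_trans (leq_trans (leq_addr _ _) ij) (ltn_ord j').
    by rewrite ltnn.
  + by rewrite block_mxEdr mxE (inj_eq (@rshift_inj _ _)).
- move=> i j; case: (split_ordP i) => i' ->; case: (split_ordP j) => j' ->.
  + by rewrite block_mxEul /= => ij; rewrite uU.
  + by rewrite /= ltnNge ltnW // ltn_addr.
  + by rewrite block_mxEdl mxE.
  + by rewrite /= (ord1 i') (ord1 j') ltnn.
Unshelve. all: by end_near. Qed.

(** Multiplying by it on the right rescales the first column only. This brings a determinant to 1
    without moving the image of the standard flag. *)
Definition scale_mx n (c : R) : 'M[R]_n.+1 :=
  diag_mx (\row_i if i == 0 then c else 1).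

Lemma det_scale_mx n c : \det (scale_mx n c) = c.
Proof.
rewrite det_diag big_ord_recl mxE eqxx big1 ?mulr1 // => i _.
by have /negbTE := neq_lift ord0 i; rewrite mxE eq_sym => ->.
Qed.

Lemma det_mul_scale n (W : 'M[R]_n.+1) :
  \det W != 0 -> \det (W *m scale_mx n (\det W)^-1) = 1.
Proof. by move=> W0; rewrite det_mulmx det_scale_mx divff. Qed.

Lemma upper_scale_mx n c : upper (scale_mx n c).
Proof. by move=> i j ij; rewrite mxE [i == j]gtn_eqF. Qed.

End Triangular.

(** * Existence of regular elements *)

Section Regular.
Context {R : realType}.

(** [x] and [y] are the real and imaginary parts of a complex eigenvector for the eigenvalue [a] + i
    [b]; the plane occurs when [b] is nonzero. *)
Lemma real_eigenline_or_plane n (M : 'M[R]_n.+1) :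
  (exists (x : 'rV_n.+1) a, x != 0 /\ x *m M = a *: x) \/
  (exists (x y : 'rV_n.+1) a b, [/\ b != 0, row_free (col_mx x y),
     x *m M = a *: x - b *: y & y *m M = b *: x + a *: y]).
Proof.
pose toC := real_complex R.
have : exists z, root (char_poly (map_mx toC M)) z.
  by apply/closed_rootP; rewrite size_char_poly.
case=> [[a b]]; rewrite -eigenvalue_root_char => /eigenvalueP[v vM v0].
pose x := map_mx (@complex.Re R) v; pose y := map_mx (@complex.Im R) v.
have xM : x *m M = a *: x - b *: y.
  apply/rowP => j; have /rowP/(_ j)/(congr1 (@complex.Re R)) := vM.
  rewrite !mxE raddf_sum /=; case: (v _ _) => v1 v2 /= <-.
  by apply: eq_bigr => k _; rewrite !mxE; case: (v _ _) => w1 w2 /=; rewrite mulr0 subr0.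
have yM : y *m M = b *: x + a *: y.
  apply/rowP => j; have /rowP/(_ j)/(congr1 (@complex.Im R)) := vM.
  rewrite !mxE raddf_sum /=; case: (v _ _) => v1 v2 /= e; rewrite addrC -e.
  by apply: eq_bigr => k _; rewrite !mxE; case: (v _ _) => w1 w2 /=; rewrite mulr0 add0r.
have xy0 : ~ (x = 0 /\ y = 0).
  case=> /rowP x0 /rowP y0; move/eqP: v0; apply; apply/rowP => j.
  by have := x0 j; have := y0 j; rewrite !mxE; case: (v _ _) => ? ? /= -> ->.
have [b0|b0] := eqVneq b 0.
  left; rewrite b0 !scale0r subr0 add0r in xM yM.
  have [x0|x0] := eqVneq x 0; last by exists x, a.
  by exists y, a; split=> //; apply/eqP => y0; apply: xy0.
right; exists x, y, a, b; split=> //.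
apply/row_freeP; apply/row_freeP; rewrite -kermx_eq0; apply/eqP/row_matrixP => i.
set u := row i _; rewrite row0.
have : u *m col_mx x y = 0 by apply/sub_kermxP; exact: row_sub.
rewrite -[u]hsubmxK mul_row_col (mx11_scalar (lsubmx u)) (mx11_scalar (rsubmx u)).
rewrite !mul_scalar_mx; set c := lsubmx u _ _; set e := rsubmx u _ _ => cxey.
(* Applying [M] to the relation [c x + e y = 0] gives [e x - c y = 0] as well; together they give
   [(c^2 + e^2) x = (c^2 + e^2) y = 0]. *)
have : (c *: x + e *: y) *m M = 0 by rewrite cxey mul0mx.
rewrite mulmxDl -!scalemxAl xM yM => H2.
have H3 : b *: (e *: x - c *: y) = 0.
  have -> : b *: (e *: x - c *: y) = c *: (a *: x - b *: y) +
      e *: (b *: x + a *: y) - a *: (c *: x + e *: y).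
    by apply/rowP => j; rewrite !mxE; ring.
  by rewrite H2 cxey scaler0 subr0.
have {}H3 : e *: x - c *: y = 0.
  by move/eqP: H3; rewrite scaler_eq0 (negbTE b0) => /eqP.
have nx : (c ^+ 2 + e ^+ 2) *: x = 0.
  have -> : (c ^+ 2 + e ^+ 2) *: x =
      c *: (c *: x + e *: y) + e *: (e *: x - c *: y).
    by apply/rowP => j; rewrite !mxE; ring.
  by rewrite cxey H3 !scaler0 addr0.
have ny : (c ^+ 2 + e ^+ 2) *: y = 0.
  have -> : (c ^+ 2 + e ^+ 2) *: y =
      e *: (c *: x + e *: y) - c *: (e *: x - c *: y).
    by apply/rowP => j; rewrite !mxE; ring.
  by rewrite cxey H3 !scaler0 subr0.
have /eqP : c ^+ 2 + e ^+ 2 = 0.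
  apply/eqP/negP => /negP n0; apply: xy0.
  split; apply/eqP; [move/eqP: nx|move/eqP: ny];
  by rewrite scaler_eq0 (negbTE n0).
rewrite paddr_eq0 ?sqr_ge0 // !sqrf_eq0 => /andP[/eqP -> /eqP ->].
by rewrite !raddf0 row_mx0.
Qed.

(* The matrix of the multiplication by a + i b. *)
Definition complex_mx (a b : R) : 'M[R]_(1 + 1) := block_mx a%:M (- b)%:M b%:M a%:M.

(** * Powers of matrices and their triangularization over the reals *)

Definition mxpow n (M : 'M[R]_n) k : 'M[R]_n := iter k (mulmx M) 1%:M.

Lemma mxpowD n (M : 'M[R]_n) k l : mxpow M (k + l) = mxpow M k *m mxpow M l.
Proof.
rewrite /mxpow iterD; elim: k => [|k IHk] /=; first by rewrite mul1mx.
by rewrite IHk mulmxA.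
Qed.

Lemma mxpowM n (M : 'M[R]_n) k l : mxpow M (k * l) = mxpow (mxpow M k) l.
Proof. by elim: l => [|l IHl]; rewrite ?muln0 // mulnS mxpowD IHl. Qed.

Lemma mxpow_trig n (M : 'M[R]_n) k : is_trig_mx M -> is_trig_mx (mxpow M k).
Proof.
move=> /is_trig_mxP tM; elim: k => [|k /is_trig_mxP IHk]; first exact: scalar_mx_is_trig.
apply/is_trig_mxP => i j ij; rewrite mxE big1 // => l _.
have [li|il] := leqP l i; last by rewrite tM ?mul0r.
by rewrite IHk ?mulr0 // (leq_ltn_trans li).
Qed.

Lemma mxpow_conj n (P M : 'M[R]_n) k : P \in unitmx ->
  mxpow (P *m M *m invmx P) k = P *m mxpow M k *m invmx P.
Proof.
move=> Pu; elim: k => [|k IHk] /=; first by rewrite mulmx1 mulmxV.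
by rewrite {1}/mxpow /= -/(mxpow _ k) IHk !mulmxA mulmxKV.
Qed.

Lemma mxpow_block p q (A : 'M[R]_p) (X : 'M[R]_(q, p)) (B : 'M[R]_q) k :
  exists Y, mxpow (block_mx A 0 X B) k = block_mx (mxpow A k) 0 Y (mxpow B k).
Proof.
elim: k => [|k [Y IHk]]; first by exists 0; exact: scalar_mx_block.
exists (X *m mxpow A k + B *m Y).
by rewrite {1}/mxpow /= -/(mxpow _ k) IHk mulmx_block !mulmx0 !mul0mx !addr0 !add0r.
Qed.

Lemma complex_mx_pow r x k : mxpow (complex_mx (r * cos x) (r * sin x)) k =
  complex_mx (r ^+ k * cos (x *+ k)) (r ^+ k * sin (x *+ k)).
Proof.
elim: k => [|k IHk].
  by rewrite /complex_mx expr0 !mulr0n cos0 sin0 mulr1 mulr0 oppr0 !raddf0; exact: scalar_mx_block.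
rewrite {1}/mxpow /= -/(mxpow _ k) IHk /complex_mx mulmx_block -!scalar_mxM -!raddfD /=.
rewrite mulrS cosD sinD exprS.
congr (block_mx _%:M _%:M _%:M _%:M); ring.
Qed.

Lemma sin_pi_int (z : int) : sin (pi * z%:~R) = 0 :> R.
Proof.
have H n : sin (pi * n%:R) = 0 :> R.
  elim: n => [|n IHn]; first by rewrite mulr0 sin0.
  by rewrite -natr1 mulrDr mulr1 sinDpi IHn oppr0.
by case: z => n; rewrite ?NegzE ?mulrNz ?mulrN ?sinN -pmulrn H ?oppr0.
Qed.

Lemma det_mx22 (A : 'M[R]_(1 + 1)) :
  \det A = A (lshift 1 0) (lshift 1 0) * A (rshift 1 0) (rshift 1 0)
         - A (lshift 1 0) (rshift 1 0) * A (rshift 1 0) (lshift 1 0).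
Proof.
have e0 : ord0 = lshift 1 (0 : 'I_1) :> 'I_(1 + 1) by exact: val_inj.
have e1 : lift ord0 (0 : 'I_1) = rshift 1 (0 : 'I_1) :> 'I_(1 + 1).
  exact: val_inj.
have e2 : lift (rshift 1 (0 : 'I_1)) (0 : 'I_1) = lshift 1 (0 : 'I_1) :> 'I_(1 + 1).
  exact: val_inj.
rewrite (expand_det_row _ ord0) big_ord_recl big_ord1 /cofactor !det_mx11 !mxE.
rewrite /= add0n expr0 expr1 !e1 e2 e0; ring.
Qed.

(* Rational multiples of pi are dense among the arguments. *)
Lemma complex_mx_near (a b : R) (U : set 'M[R]_(1 + 1)) : nbhs (complex_mx a b) U ->
  exists a' b' m c, [/\ U (complex_mx a' b'), \det (complex_mx a' b') = \det (complex_mx a b)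
    & mxpow (complex_mx a' b') m.+1 = c%:M].
Proof.
move=> nU.
(* Polar form; the sign of [b] decides between [acos] and its opposite. *)
have [r [th [ea eb]]] : exists r th, a = r * cos th /\ b = r * sin th.
  pose r := Num.sqrt (a ^+ 2 + b ^+ 2).
  have r2 : r ^+ 2 = a ^+ 2 + b ^+ 2 by rewrite sqr_sqrtr // addr_ge0 ?sqr_ge0.
  have [r0|r0] := eqVneq r 0.
    exists 0, 0; move: r2; rewrite r0 expr0n /= => /esym/eqP.
    by rewrite paddr_eq0 ?sqr_ge0 // !sqrf_eq0 !mul0r => /andP[/eqP -> /eqP ->].
  have ar : (a / r) ^+ 2 + (b / r) ^+ 2 = 1.
    by rewrite !expr_div_n -mulrDl -r2 divff // expf_neq0.
  have ar1 : -1 <= a / r <= 1.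
    rewrite -ler_norml -(expr_le1 (ltn0Sn 1)) // real_normK ?num_real //.
    by rewrite -ar lerDl sqr_ge0.
  have rgt0 : 0 < r by rewrite lt_def r0 sqrtr_ge0.
  have sa : r * sin (acos (a / r)) = `|b|.
    rewrite sin_acos // -ar [X in X - _]addrC addrK sqrtr_sqr.
    by rewrite normrM normfV (gtr0_norm rgt0) mulrC divfK.
  have ca : r * cos (acos (a / r)) = a.
    by rewrite acosK ?in_itv //= mulrC divfK.
  have [b0|b0] := leP 0 b.
    by exists r, (acos (a / r)); rewrite ca sa ger0_norm.
  exists r, (- acos (a / r)); rewrite cosN sinN mulrN ca sa ltr0_norm //.
  by rewrite opprK.
pose f t := complex_mx (r * cos (pi * t)) (r * sin (pi * t)).
have fc : f @ (th / pi) --> complex_mx a b.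
  have ct : (fun t : R => pi * t) @ (th / pi) --> th.
    have {2}-> : th = pi * (th / pi) by rewrite mulrC divfK // gt_eqF ?pi_gt0.
    by apply: cvgM; [exact: cvg_cst|exact: cvg_id].
  have c1 : (fun t : R => r * cos (pi * t)) @ (th / pi) --> a.
    rewrite ea; apply: cvgM; first exact: cvg_cst.
    by apply: (@continuous_cvg _ _ _ _ _ _ cos) => //; exact: continuous_cos.
  have c2 : (fun t : R => r * sin (pi * t)) @ (th / pi) --> b.
    rewrite eb; apply: cvgM; first exact: cvg_cst.
    by apply: (@continuous_cvg _ _ _ _ _ _ sin) => //; exact: continuous_sin.
  apply/cvg_mxP => i j; rewrite /f /complex_mx.
  case: (split_ordP i) => i' ->; case: (split_ordP j) => j' ->.
  - rewrite block_mxEul !mxE ord1 (ord1 j') eqxx mulr1n.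
    by under eq_cvg do rewrite block_mxEul mxE eqxx mulr1n.
  - rewrite block_mxEur !mxE ord1 (ord1 j') eqxx mulr1n.
    by under eq_cvg do rewrite block_mxEur mxE eqxx mulr1n; exact: cvgN.
  - rewrite block_mxEdl !mxE ord1 (ord1 j') eqxx mulr1n.
    by under eq_cvg do rewrite block_mxEdl mxE eqxx mulr1n.
  - rewrite block_mxEdr !mxE ord1 (ord1 j') eqxx mulr1n.
    by under eq_cvg do rewrite block_mxEdr mxE eqxx mulr1n.
have nV : nbhs (th / pi) (f @^-1` U) by apply: fc.
have [||x0 [oU [q _ qx]]] := @dense_rat R (f @^-1` U)^°.
- by exists (th / pi).
- exact: open_interior.
rewrite -qx in oU.
(* The argument becomes [pi * t] with [t] rational. The power by the denominator of [t] has an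
   integer multiple of pi as argument, so its sine vanishes and it is scalar. The modulus [r], hence
   the determinant, is unchanged. *)
pose t : R := ratr q; have Ut : U (f t) by exact: interior_subset oU.
exists (r * cos (pi * t)), (r * sin (pi * t)), `|denq q|.-1%N,
  (r ^+ `|denq q| * cos ((pi * t) *+ `|denq q|)); split=> //.
  have det_cmx x y : \det (complex_mx x y) = x ^+ 2 + y ^+ 2.
    by rewrite det_mx22 /complex_mx block_mxEul block_mxEur block_mxEdl block_mxEdr !mxE
      /=; ring.
  by rewrite !det_cmx ea eb !exprMn -!mulrDr !cos2Dsin2.
rewrite prednK ?absz_gt0 ?denq_neq0 // complex_mx_pow /complex_mx.
have -> : sin ((pi * t) *+ `|denq q|) = 0.
  rewrite -mulrnAr -mulr_natr natr_absz gtr0_norm ?denq_gt0 //.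
  have -> : t * (denq q)%:~R = (numq q)%:~R.
    by rewrite /t -(ratr_int R (numq q)) -(ratr_int R (denq q)) -rmorphM numqE.
  exact: sin_pi_int.
by rewrite mulr0 oppr0 !raddf0 -scalar_mx_block.
Qed.


(** The exponent [m.+1] excludes the power 0, which is always triangular. *)
Definition power_triangularizable n (M : 'M[R]_n) : Prop :=
  exists m P T,
    [/\ P \in unitmx, is_trig_mx T & P *m mxpow M m.+1 = T *m P].

(** The product of the exponents that work for [A] and for [B] works for both blocks. *)
Lemma power_triangularizable_block p q (A : 'M[R]_p) (X : 'M[R]_(q, p))
    (B : 'M[R]_q) (P : 'M[R]_(p + q)) m :
  P \in unitmx -> is_trig_mx (mxpow A m.+1) -> power_triangularizable B ->
  power_triangularizable (invmx P *m block_mx A 0 X B *m P).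
Proof.
move=> Pu tA [m' [Q [T [Qu tT eT]]]]; exists (m.+1 * m'.+1).-1%N.
have -> : (m.+1 * m'.+1).-1.+1 = (m.+1 * m'.+1)%N by rewrite prednK ?muln_gt0.
have [Y eY] := mxpow_block A X B (m.+1 * m'.+1).
have [T' tT' eT'] : exists2 T', is_trig_mx T' & Q *m mxpow B (m.+1 * m'.+1) = T' *m Q.
  exists (mxpow T m.+1); first exact: mxpow_trig.
  rewrite mulnC mxpowM -[mxpow B _](mulKmx Qu) eT mulmxA.
  have := @mxpow_conj _ (invmx Q) T m.+1; rewrite unitmx_inv invmxK => -> //.
  by rewrite !mulmxA mulmxV // mul1mx.
exists (block_mx 1%:M 0 0 Q *m P), (block_mx (mxpow A (m.+1 * m'.+1)) 0 (Q *m Y) T').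
split.
- by rewrite unitmx_mul Pu andbT unitmxE det_ublock det1 mul1r -unitmxE.
- by rewrite is_trig_block_mx // eqxx tT' mxpowM mxpow_trig.
have := @mxpow_conj _ (invmx P) (block_mx A 0 X B) (m.+1 * m'.+1).
rewrite unitmx_inv invmxK => -> //. rewrite eY !mulmxA mulmxK //.
by rewrite !mulmx_block !mulmx0 !mul0mx !mul1mx !mulmx1 !addr0 !add0r eT'.
Qed.

(** Induction on the size: an invariant line or plane puts [M] in block triangular form, and the two
    diagonal blocks are perturbed separately without changing their determinants. On a plane the
    block is a complex number, whose argument is made rational. *)
Lemma dense_power_triangularizable n (M : 'M[R]_n) (U : set 'M[R]_n) :
  nbhs M U -> exists M', [/\ U M', \det M' = \det M & power_triangularizable M'].
Proof.
have [k] := ubnP n; elim: k n M U => // k IHk [|n] M U nk nU.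
  exists M; split=> //; first exact: nbhs_singleton.
  exists 0, 1%:M, 0; split; [exact: unitmx1|exact: mx0_is_trig|].
  by rewrite [LHS]flatmx0 [RHS]flatmx0.
(* Reduction of the dimension by an invariant subspace, in row convention. *)
have key p q (V : 'M[R]_(p, p + q)) (A : 'M[R]_p) (N : 'M[R]_(p + q)) U' :
    (0 < p)%N -> (p + q < k.+1)%N -> nbhs N U' -> row_free V -> V *m N = A *m V ->
    (forall UA, nbhs A UA -> exists A' m, [/\ UA A', \det A' = \det A
       & is_trig_mx (mxpow A' m.+1)]) ->
    exists M', [/\ U' M', \det M' = \det N & power_triangularizable M'].
  move=> p0 pqk nU' Vf VN HA.
  (* The rows of [V] are completed to a basis. *)
  have [P Pu PV] : exists2 P, P \in unitmx & usubmx P = V.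
    exists (block_mx (col_ebase V) 0 0 1%:M *m row_ebase V).
      by rewrite unitmx_mul row_ebase_unit andbT unitmxE det_ublock det1 mulr1
        -unitmxE col_ebase_unit.
    rewrite -mul_usub_mx block_mxEv col_mxKu -[RHS]mulmx_ebase (eqP Vf).
    rewrite [pid_mx _](_ : _ = row_mx 1%:M 0) ?mul_mx_row ?mulmx1 ?mulmx0 //.
    by rewrite -[LHS]hsubmxK; congr row_mx; apply/matrixP => i j;
      rewrite !mxE /= -?val_eqE /= ?ltn_ord ?andbT // ltn_eqF // ltn_addr.
  pose X := dlsubmx (P *m N *m invmx P); pose B := drsubmx (P *m N *m invmx P).
  have eN : N = invmx P *m block_mx A 0 X B *m P.
    have -> : block_mx A 0 X B = P *m N *m invmx P.
      have uV : usubmx (P *m N *m invmx P) = row_mx A 0.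
        rewrite -!mul_usub_mx PV VN -PV -mulmxA mul_usub_mx mulmxV //.
        rewrite scalar_mx_block block_mxEv col_mxKu.
        by rewrite mul_mx_row mulmx1 mulmx0.
      by rewrite -[RHS]submxK /ulsubmx /ursubmx uV row_mxKl row_mxKr.
    by rewrite !mulmxA mulVmx // mul1mx mulmxKV.
  pose f (z : 'M[R]_p * 'M[R]_q) := invmx P *m block_mx z.1 0 X z.2 *m P.
  have fc : f @ (filter_prod (nbhs A) (nbhs B)) --> N.
    rewrite eN; apply: (@cvg_mulmx _ _ _ _ _ _ _
      (fun z => invmx P *m block_mx z.1 0 X z.2) (fun=> P)); last exact: cvg_cst.
    apply: cvg_mulmx; first exact: cvg_cst.
    have c1 : fst @ filter_prod (nbhs A) (nbhs B) --> A by exact: cvg_fst.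
    have c2 : snd @ filter_prod (nbhs A) (nbhs B) --> B by exact: cvg_snd.
    move/cvg_mxP: c1 => c1; move/cvg_mxP: c2 => c2.
    apply/cvg_mxP => i j.
    case: (split_ordP i) => i' ->; case: (split_ordP j) => j' ->.
    - by rewrite block_mxEul; under eq_cvg do rewrite block_mxEul; exact: c1.
    - by rewrite block_mxEur; under eq_cvg do rewrite block_mxEur; exact: cvg_cst.
    - by rewrite block_mxEdl; under eq_cvg do rewrite block_mxEdl; exact: cvg_cst.
    - by rewrite block_mxEdr; under eq_cvg do rewrite block_mxEdr; exact: c2.
  have [[UA UB] /= [nA nB] sU] := fc _ nU'.
  have [A' [m [UA' dA' tA']]] := HA _ nA.
  have [|B' [UB' dB' tB']] := IHk q B UB _ nB.
    by rewrite -ltnS (leq_trans _ pqk) // ltnS -addn1 addnC leq_add2r.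
  exists (f (A', B')); split.
  - exact: (sU (A', B')).
  - by rewrite {1}/f eN !det_mulmx !det_lblock dA' dB'.
  - exact: power_triangularizable_block tA' tB'.
have [[x [a [x0 xM]]]|[x [y [a [b [b0 xyf xM yM]]]]]] := real_eigenline_or_plane M.
  move: M U x xM x0 nU nk; rewrite -[n.+1]add1n => M U x xM x0 nU nk.
  apply: (key 1%N n x a%:M) => //.
  - by rewrite /row_free rank_rV x0.
  - by rewrite mul_scalar_mx.
  - move=> UA nA; exists a%:M, 0; split=> //; first exact: nbhs_singleton.
    by rewrite /mxpow /= mulmx1 scalar_mx_is_trig.
have n1 : (0 < n)%N.
  have := rank_leq_col (col_mx x y); by rewrite (eqP xyf) add1n ltnS.
case: n n1 => // n _ in M U x y xM yM xyf nU nk *.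
move: M U x y xM yM xyf nU nk; rewrite -[n.+2]/(1 + 1 + n)%N => M U x y xM yM xyf nU nk.
apply: (key (1 + 1)%N n (col_mx x y) (complex_mx a b)) => //.
  by rewrite mul_col_mx xM yM /complex_mx mul_block_col !mul_scalar_mx scaleNr.
move=> UA /complex_mx_near[a' [b' [m [c [UA' dA' eA']]]]].
by exists (complex_mx a' b'), m; rewrite eA' scalar_mx_is_trig.
Qed.

(** * Diagonalization with distinct moduli *)

Lemma decreasing_perm n (f : 'I_n -> R) : injective f ->
  exists s : 'S_n, forall i j : 'I_n, (i < j)%N -> f (s j) < f (s i).
Proof.
move=> fi; pose t := [tuple - f i | i < n].
have : perm_eq (sort <=%O t) t by rewrite perm_sort.
have szt : size (sort <=%O t) == n by rewrite size_sort size_tuple.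
rewrite -[sort _ _]/(tval (Tuple szt)) => /tuple_permP[s /= es].
exists s => i j ij.
have ut : uniq t by rewrite map_inj_uniq ?enum_uniq // => x y /oppr_inj/fi.
have nE (l : 'I_n) : nth 0 (sort <=%O t) l = - f (s l).
  by rewrite es (nth_map l) ?size_enum_ord // nth_ord_enum tnth_mktuple.
rewrite -ltrN2 -!nE lt_sorted_ltn_nth // ?sort_lt_sorted // inE es size_map;
  by rewrite size_enum_ord.
Qed.

Lemma trig_diag_eigenvalue n (T : 'M[R]_n) i : is_trig_mx T -> eigenvalue T (T i i).
Proof.
move=> tT; rewrite eigenvalue_root_char char_poly_trig //.
by rewrite /root horner_prod (bigD1 i) //= hornerXsubC subrr mul0r.
Qed.

Lemma trig_diagonalize n (T : 'M[R]_n.+1) :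
  is_trig_mx T -> injective (fun i => `|T i i|) ->
  exists P lam, [/\ P \in unitmx, P *m T = diag_mx lam *m P
    & forall i j : 'I_n.+1, (i < j)%N -> `|lam 0 j| < `|lam 0 i|].
Proof.
move=> tT iT.
have [Q Qu /diagonalizable_forPex[D QTD]] : diagonalizable T.
  apply/diagonalizableP; exists [seq T i i | i <- enum 'I_n.+1].
    by rewrite map_inj_uniq ?enum_uniq // => i j eij; apply: iT; rewrite /= eij.
  by rewrite big_map big_enum /= -char_poly_trig // mxminpoly_dvd_char.
have {}QTD : Q *m T = diag_mx D *m Q.
  by have /simmxPp := QTD; apply; rewrite ?stablemx_unit.
(* An eigenvector of [T] for [T i i] has a nonzero coordinate [j] in the eigenbasis [Q], which
   forces [D 0 j = T i i]. Hence the moduli of [D] contain [n.+1] distinct values and are themselves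
   distinct. *)
have DT i : exists j, D 0 j = T i i.
  have /eigenvalueP[v vT v0] := trig_diag_eigenvalue i tT.
  have [j wj] : exists j, (v *m invmx Q) 0 j != 0.
    apply/existsP; apply: contraNT v0; rewrite negb_exists => /forallP H.
    rewrite -(mulmxKV Qu v); apply/eqP; rewrite -[RHS](mul0mx _ Q); congr (_ *m _).
    by apply/rowP => j; rewrite [RHS]mxE; apply/eqP; exact: negbNE (H j).
  exists j; apply: (mulfI wj).
  have : v *m invmx Q *m diag_mx D = T i i *: (v *m invmx Q).
    rewrite -[LHS](mulmxK Qu) -(mulmxA _ _ Q) -QTD mulmxA mulmxKV // vT.
    by rewrite scalemxAl.
  by move/rowP/(_ j); rewrite mul_mx_diag !mxE mulrC => ->; rewrite mulrC.
have iD : injective (fun i => `|D 0 i|).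
  apply/injectiveP; rewrite /injectiveb /dinjectiveb.
  apply: (@leq_size_uniq _ [seq `|T i i| | i <- enum 'I_n.+1]).
  - by rewrite map_inj_uniq ?enum_uniq.
  - move=> _ /mapP[i _ ->]; have [j <-] := DT i.
    by apply/mapP; exists j => //; rewrite mem_enum.
  - by rewrite !size_map.
have [s sD] := decreasing_perm iD.
exists (row_perm s Q), (\row_j D 0 (s j)); split.
- by rewrite row_permE unitmx_mul unitmx_perm.
- apply/matrixP => i j; transitivity ((Q *m T) (s i) j).
    by rewrite !mxE; apply: eq_bigr => k _; rewrite mxE.
  by rewrite QTD !mul_diag_mx !mxE.
- by move=> i j ij; rewrite !mxE; exact: sD.
Qed.

(** Right translation by the inverse of [h] carries a neighbourhood of [g * h] to one of [g]. *)
Lemma semigroup_interiorM d (S : set (SL R d)) g h :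
  is_semigroup S -> S° g -> S h -> S° (g * h)%g.
Proof.
move=> sS Sg Sh.
have H : (fun x => x * h^-1)%g @ nbhs (g * h)%g --> g.
  rewrite -[X in _ --> X](mulgK h).
  have FF : Filter (nbhs (g * h)%g) by exact: (@nbhs_filter (SL R d)).
  by apply: (@cvg_slmul R _ _ FF d id (fun=> (h^-1)%g)); [exact: cvg_id|exact: cvg_cst].
have := H S Sg.
have FF : Filter (nbhs (g * h)%g) by exact: (@nbhs_filter (SL R d)).
apply: (@filterS _ _ FF) => x Sx.
by rewrite -(mulgVK h x); apply: sS.
Qed.

(** Near an interior point there is a matrix with a triangularizable power. This power is again
    interior, so its triangular form can be multiplied by a diagonal matrix close to 1 that
    separates the moduli of the diagonal entries. *)
Lemma semigroup_regular n (S : set (SL R n.+1)) :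
  is_semigroup S -> S° !=set0 ->
  exists (h P : SL R n.+1) (lam : 'rV[R]_n.+1), [/\ S h,
    forall i j : 'I_n.+1, (i < j)%N -> `|lam 0 j| < `|lam 0 i|
    & slval h *m slval P = slval P *m diag_mx lam].
Proof.
move=> sS [g0 Sg0].
have extend (g : SL R n.+1) : S° g -> exists2 C : set 'M[R]_n.+1,
    nbhs (slval g) C & forall x : SL R n.+1, C (slval x) -> S° x.
  move=> Sg; have [C oC eC] := @open_interior _ S.
  exists C; first by apply: open_nbhs_nbhs; split=> //; rewrite -eC in Sg.
  by move=> x Cx; rewrite -eC.
have [C0 nC0 C0S] := extend _ Sg0.
have [M [C0M dM [m [Q [T [Qu tT QM]]]]]] := dense_power_triangularizable nC0.
rewrite SL_det in dM; move/eqP: dM => dM.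
have [g [Sg eg]] : exists g : SL R n.+1, S° g /\ slval g = mxpow M m.+1.
  elim: {QM T tT Q Qu} m => [|m [g [Sg eg]]].
    by exists (MkSL dM); split; [exact: C0S|rewrite /mxpow /= mulmx1].
  exists (MkSL dM * g)%g; split; last by rewrite /= eg.
  by apply: semigroup_interiorM => //; [exact: C0S|exact: interior_subset].
rewrite -eg in QM.
have [C nC CS] := extend _ Sg.
have eT : T = Q *m slval g *m invmx Q by rewrite QM mulmxK.
have eg' : slval g = invmx Q *m T *m Q by rewrite -mulmxA -QM mulKmx.
have dT : \det T = 1.
  by rewrite eT !det_mulmx SL_det mulr1 -det_mulmx mulmxV // det1.
have T0 i : `|T i i| != 0.
  move: dT; rewrite normr_eq0 det_trig // => dT; apply/eqP => Ti0.
  by move/eqP: dT; rewrite (bigD1 i) //= Ti0 mul0r eq_sym oner_eq0.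
(* The exponents [2 i - n] are pairwise distinct and their sum is 0: the moduli get separated for
   [x] close to 1 but different from it, and the determinant stays 1. *)
pose del (x : R) : 'rV[R]_n.+1 := \row_i (x ^+ i / x ^+ (n - i)).
pose M' x := invmx Q *m (T *m diag_mx (del x)) *m Q.
have delc : (fun x => diag_mx (del x)) @ (1 : R) --> (1%:M : 'M[R]_n.+1).
  have ec k : (fun x : R => x ^+ k) @ (1 : R) --> (1 : R).
    by have := @exprn_continuous R k 1; rewrite /continuous_at expr1n.
  have dc k l : (fun x : R => x ^+ k / x ^+ l) @ (1 : R) --> (1 : R).
    rewrite -[X in _ --> X]divr1; apply: cvgM; first exact: ec.
    by apply: cvgV; [exact: oner_neq0|exact: ec].
  apply/cvg_mxP => i j; rewrite !mxE; under eq_cvg do rewrite !mxE.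
  by case: eqVneq => _ /=; [exact: dc|exact: cvg_cst].
have M'c : M' @ (1 : R) --> slval g.
  rewrite eg' -[T in _ *m T *m _]mulmx1.
  apply: (@cvg_mulmx _ _ _ _ _ _ _
    (fun x => invmx Q *m (T *m diag_mx (del x))) (fun=> Q)); last exact: cvg_cst.
  apply: cvg_mulmx; first exact: cvg_cst.
  by apply: cvg_mulmx; first exact: cvg_cst.
have nM' : \forall x \near (1 : R)^', C (M' x).
  by apply: nbhs_dnbhs; exact: M'c.
(* The condition is multiplied by [x ^+ (n - i) * x ^+ (n - j)] to become polynomial in [x]. *)
have nd : \forall x \near (1 : R)^', forall i j : 'I_n.+1, i != j ->
    `|T i i| * x ^+ (i + (n - j)) != `|T j j| * x ^+ (j + (n - i)).
  apply: filter_forall => i; apply: filter_forall => j.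
  have [->|ij] := eqVneq i j; first by apply: nearW.
  pose p : {poly R} := `|T i i| *: 'X^(i + (n - j)) - `|T j j| *: 'X^(j + (n - i)).
  have p0 : p != 0.
    apply/eqP => /polyP/(_ (i + (n - j))%N); rewrite !coefE eqxx mulr1.
    have -> : (i + (n - j) == j + (n - i))%N = false.
      apply/negbTE; apply: contra ij => /eqP e; apply/eqP/val_inj => /=.
      have := ltn_ord i; have := ltn_ord j; move: e; lia.
    by rewrite mulr0 subr0 => /eqP; apply/negP.
  have := near_horner_neq0 1 p0; apply: filterS => x + _.
  by rewrite !hornerE subr_eq0.
have n0 : \forall x \near (1 : R)^', 0 < x.
  by apply: nbhs_dnbhs; apply: lt_nbhsr; exact: ltr01.
near (1 : R)^' => x.
have x0 : 0 < x by near: x.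
have dx : \det (diag_mx (del x)) = 1.
  rewrite det_diag; under eq_bigr do rewrite mxE.
  rewrite big_split /= prodfV [X in X / _](reindex_inj rev_ord_inj) /=.
  under eq_bigr do rewrite subSS.
  by rewrite divff //; apply/prodf_neq0 => i _; rewrite expf_neq0 ?gt_eqF.
have tT' : is_trig_mx (T *m diag_mx (del x)).
  apply/is_trig_mxP => i j ij; rewrite mul_mx_diag mxE.
  by have /is_trig_mxP -> := tT; rewrite ?mul0r.
have dM' : \det (M' x) == 1.
  by rewrite /M' !det_mulmx dx mulr1 dT mulr1 -det_mulmx mulVmx // det1.
have iT' : injective (fun i => `|(T *m diag_mx (del x)) i i|).
  move=> i j; rewrite !mul_mx_diag !mxE !normrM !normfV !normrX (gtr0_norm x0).
  move=> e; apply/eqP/negPn/negP => ij.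
  have /(_ i j ij)/eqP : forall i j : 'I_n.+1, i != j ->
    `|T i i| * x ^+ (i + (n - j)) != `|T j j| * x ^+ (j + (n - i)) by near: x.
  apply; rewrite !exprD.
  have xi k : x ^+ k != 0 by rewrite expf_neq0 ?gt_eqF.
  have -> : `|T i i| * (x ^+ i * x ^+ (n - j)) =
      `|T i i| * (x ^+ i / x ^+ (n - i)) * (x ^+ (n - i) * x ^+ (n - j)).
    by field; rewrite xi.
  by rewrite e; field; rewrite xi.
have [P [lam [Pu PT lamd]]] := trig_diagonalize tT' iT'.
pose W := invmx Q *m invmx P; pose e := scale_mx n (\det W)^-1.
have W0 : \det W != 0.
  by rewrite -unitfE -unitmxE unitmx_mul !unitmx_inv Qu Pu.
have /eqP dWe := det_mul_scale W0.
exists (MkSL dM'), (MkSL dWe), lam; split => //=.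
  by apply: interior_subset; apply: CS => /=; near: x.
have -> : M' x = W *m diag_mx lam *m (P *m Q).
  rewrite /M' /W -!mulmxA; congr (_ *m _).
  by rewrite [diag_mx lam *m _]mulmxA -PT -!mulmxA mulKmx.
have PQW : P *m Q *m W = 1%:M by rewrite /W !mulmxA mulmxK // mulmxV.
rewrite -[LHS]mulmxA (mulmxA (P *m Q)) PQW mul1mx -!mulmxA; congr (_ *m _).
by rewrite /e /scale_mx diag_mxC.
Unshelve. all: by end_near. Qed.
End Regular.

(** * Flags as cosets *)

Section Flags.
Context {R : realType}.

(** * Standard flags and their stabilizers *)

Section StdFlag.
Context {d : nat}.
Implicit Types (Th : {set ThetaM d}) (g h X Y : SL R d).

Definition stdv (r : nat) : {vspace 'cV[R]_d} :=
  limg (linfun (mulmx (pid_mx r : 'M[R]_(d, r)))).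

Lemma mem_stdv r (v : 'cV[R]_d) :
  reflect (forall i : 'I_d, (r <= i)%N -> v i 0 = 0) (v \in stdv r).
Proof.
apply: (iffP memv_imgP) => [[w _ ->] i ri|v0].
  rewrite lfunE /= mxE big1 // => k _.
  by rewrite mxE ltnNge ri andbF mul0r.
exists (pid_mx r *m v); first exact: memvf.
rewrite lfunE /= mulmxA; apply/colP => i; rewrite !mxE (bigD1 i) //= big1 => [|k ki].
  rewrite addr0 mxE; have [ir|ri] := ltnP i r; last by rewrite v0 // mulr0.
  rewrite (bigD1 (Ordinal ir)) //= big1 => [|k ki]; rewrite !mxE ?eqxx ?ir /=.
    by rewrite addr0 !mul1r.
  by rewrite -val_eqE /= in ki; rewrite eq_sym (negbTE ki) mul0r.
rewrite mxE big1 ?mul0r // => l _; rewrite !mxE.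
have [<-|] := eqVneq (i : nat) l; last by rewrite mul0r.
by rewrite -val_eqE /= in ki; rewrite eq_sym (negbTE ki) mulr0.
Qed.

Lemma dim_stdv r : (r <= d)%N -> \dim (stdv r) = r.
Proof.
move=> rd; rewrite /stdv; set f := linfun _.
suff kf : lker f = 0%VS.
  by rewrite limg_dim_eq ?kf ?capv0 // dimvf /dim /= muln1.
apply/eqP/lker0P => x y; rewrite !lfunE /= => /colP exy; apply/colP => i.
have E (z : 'cV[R]_r) : (pid_mx r *m z) (widen_ord rd i) 0 = z i 0.
  rewrite mxE (bigD1 i) //= big1 => [|k ki]; rewrite mxE /= ?eqxx ?ltn_ord ?mul1r ?addr0 //.
  by rewrite -val_eqE /= in ki; rewrite eq_sym (negbTE ki) mul0r.
by have := exy (widen_ord rd i); rewrite !E.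
Qed.

Lemma std_flag_subproof Th :
  is_flag [ffun r : {r | r \in Th} => stdv (rk (val r))].
Proof.
apply/andP; split; apply/forallP => r.
  by rewrite ffunE dim_stdv // ltnW // ltn_ord.
apply/forallP => s; apply/implyP => rs; rewrite !ffunE.
apply/subvP => v /mem_stdv v0; apply/mem_stdv => i si.
by apply: v0; exact: leq_trans si.
Qed.
Definition std_flag Th : flag R Th := Flag (std_flag_subproof Th).

Lemma flag_actM Th g h (V : flag R Th) :
  flag_act (g * h)%g V = flag_act g (flag_act h V).
Proof.
apply: val_inj; apply/ffunP => r; rewrite !ffunE -limg_comp; congr (_ @: _)%VS.
by apply/lfunP => v; rewrite comp_lfunE !lfunE /= mulmxA.
Qed.

Lemma flag_act1 Th (V : flag R Th) : flag_act 1%g V = V.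
Proof.
apply: val_inj; apply/ffunP => r; rewrite !ffunE -[RHS]lim1g; congr (_ @: _)%VS.
by apply/lfunP => v; rewrite !lfunE /= mul1mx.
Qed.

Lemma flag_proj_act Th g V : flag_proj Th (flag_act g V) = flag_act g (flag_proj Th V).
Proof. by apply: val_inj; apply/ffunP => r; rewrite !ffunE. Qed.

Lemma flag_proj_std Th : flag_proj Th (std_flag [set: ThetaM d]%SET) = std_flag Th.
Proof. by apply: val_inj; apply/ffunP => r; rewrite !ffunE. Qed.

(** Block upper triangular matrices; within [SL R d], the stabilizer of the standard flag of type
    [Th]. *)
Definition parabolic Th (p : 'M[R]_d) : Prop :=
  forall r : ThetaM d, r \in Th -> forall i j : 'I_d, (j < r)%N -> (r <= i)%N -> p i j = 0.

Lemma mulmx_stdv (p : 'M[R]_d) r v :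
  (forall i j : 'I_d, (j < r)%N -> (r <= i)%N -> p i j = 0) ->
  v \in stdv r -> p *m v \in stdv r.
Proof.
move=> pr /mem_stdv v0; apply/mem_stdv => i ri; rewrite mxE big1 // => j _.
by have [jr|rj] := ltnP j r; [rewrite pr ?mul0r|rewrite v0 ?mulr0].
Qed.

Lemma stab_std_flag Th g :
  flag_act g (std_flag Th) = std_flag Th <-> parabolic Th (slval g).
Proof.
split=> [e r rT i j jr ri|pg].
  have := congr1 (fun V : flag R Th => V (exist _ r rT)) e; rewrite !ffunE /= => er.
  have : linfun (mulmx (slval g)) (delta_mx j 0 : 'cV[R]_d) \in stdv r.
    rewrite -er memv_img //; apply/mem_stdv => l rl.
    by rewrite mxE -val_eqE /= gtn_eqF // (leq_trans jr).
  rewrite lfunE /= -colE => /mem_stdv/(_ _ ri).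
  by rewrite mxE.
apply: val_inj; apply/ffunP => r; rewrite !ffunE.
apply/eqP; rewrite eqEdim; apply/andP; split.
  apply/subvP => _ /memv_imgP[v vr ->]; rewrite lfunE /=; apply: mulmx_stdv => //.
  by apply: pg; exact: valP r.
have /andP[/forallP/(_ r)/eqP + _] := valP (flag_act g (std_flag Th)).
rewrite /= !ffunE => ->.
by rewrite dim_stdv // ltnW // ltn_ord.
Qed.
End StdFlag.

(** The next vector is chosen outside the span of the previous ones in the smallest subspace of the
    flag of dimension greater than [j], hence in all the larger ones. *)
Lemma adapted_family d (Th : {set ThetaM d}) (V : flag R Th) j : (j <= d)%N ->
  exists s : seq 'cV[R]_d, [/\ size s = j, free s &
    forall (r : {r | r \in Th}) i, (i < j)%N -> (i < rk (val r))%N -> s`_i \in V r].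
Proof.
have /andP[/forallP dV /forallP sV] := valP V.
elim: j => [|j IHj] jd; first by exists [::]; split => //; exact: nil_free.
have [s [sj fs sVs]] := IHj (ltnW jd).
have [v vs vV] : exists2 v, v \notin span s &
    forall r : {r | r \in Th}, (j < rk (val r))%N -> v \in V r.
  have dvs (W : {vspace 'cV[R]_d}) : (j < \dim W)%N -> exists2 v, v \in W & v \notin span s.
    move=> jW; apply/subvPn; apply/negP => /dimvS; rewrite leqNgt.
    by rewrite (leq_ltn_trans (dim_span s)) ?sj.
  have [/existsP[r0 jr0]|/existsPn nr] :=
      boolP [exists r : {r | r \in Th}, (j < rk (val r))%N].
    have [r jr rmin] := @arg_minnP _ r0 (fun r : {r | r \in Th} => (j < rk (val r))%N)
      (fun r => rk (val r)) jr0.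
    have [|v vr vs] := dvs (V r); first by rewrite (eqP (dV r)).
    exists v => // r' jr'; have /forallP/(_ r')/implyP := sV r.
    by move=> /(_ (rmin _ jr'))/subvP; apply.
  have [|v _ vs] := dvs fullv; first by rewrite dimvf /dim /= muln1.
  by exists v => // r; rewrite (negbTE (nr r)).
exists (rcons s v); split; first by rewrite size_rcons sj.
  by rewrite (perm_free (_ : perm_eq _ (v :: s))) ?perm_rcons // free_cons vs.
move=> r i; rewrite ltnS leq_eqVlt nth_rcons sj => /orP[/eqP -> jr|ij ir].
  by rewrite ltnn eqxx vV.
by rewrite ij sVs.
Qed.

(** The columns of [X] form a basis adapted to the flag, the first one rescaled to get determinant
    1. *)
Lemma flag_transitive n (Th : {set ThetaM n.+1}) (V : flag R Th) :
  exists X : SL R n.+1, V = flag_act X (std_flag Th).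
Proof.
have [s [sn fs sV]] := adapted_family V (leqnn _).
have /andP[/forallP dV _] := valP V.
pose X : 'M[R]_n.+1 := \matrix_(i, j) s`_j i 0.
have XE w : X *m w = \sum_(j < n.+1) w j 0 *: s`_j.
  apply/colP => i; rewrite mxE summxE; apply: eq_bigr => j _.
  by rewrite !mxE mulrC.
have X0 : \det X != 0.
  apply/negP => /eqP; rewrite -det_tr => /eqP/det0P[v v0 vX].
  have : X *m v^T = 0 by apply: trmx_inj; rewrite trmx_mul trmxK vX trmx0.
  rewrite XE => e; move/eqP: v0; apply; apply/rowP => j; rewrite mxE.
  have fs' : free (Tuple (introT eqP sn)) by [].
  have /freeP := fs'; move=> /(_ (fun j => v^T j 0)) /= /(_ e j).
  by rewrite mxE.
have /eqP dX := det_mul_scale X0.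
exists (MkSL dX); apply: val_inj; apply/ffunP => r; rewrite !ffunE.
apply/esym/eqP; rewrite eqEdim.
have -> : \dim (linfun (mulmx (slval (MkSL dX))) @: stdv (rk (val r)))%VS = rk (val r).
  have /andP[/forallP/(_ r)/eqP + _] := valP (flag_act (MkSL dX) (std_flag Th)).
  by rewrite /= !ffunE.
rewrite (eqP (dV r)) leqnn andbT.
apply/subvP => _ /memv_imgP[v /mem_stdv v0 ->]; rewrite lfunE /= -mulmxA XE.
apply: rpred_sum => j _; have [jr|rj] := ltnP j (rk (val r)).
  by rewrite rpredZ // sV.
by rewrite mul_diag_mx mxE v0 // mulr0 scale0r rpred0.
Qed.

Section Topology.
Context {d : nat}.
Implicit Types (Th : {set ThetaM d}).

Lemma continuous_flag_actl Th (V : flag R Th) : continuous (fun g => flag_act g V).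
Proof. by apply/continuousP => U oU; exact: (oU V). Qed.

Lemma flag_openP Th (U : set (flag R Th)) : open U <-> flag_open U.
Proof. by []. Qed.

Lemma slmul_continuousl (g : SL R d) : continuous (fun h : SL R d => (g * h)%g).
Proof.
move=> h.
apply: (@cvg_slmul R _ _ (@nbhs_filter (SL R d) h) d (fun=> g) id);
  [exact: cvg_cst|exact: cvg_id].
Qed.

Lemma continuous_flag_actr Th (g : SL R d) : continuous (flag_act (Th := Th) g).
Proof.
apply/continuousP => U /flag_openP oU; apply/flag_openP => V.
rewrite [X in open X](_ : _ = (fun h => (g * h)%g) @^-1` [set h | U (flag_act h V)]).
  by have /continuousP := @slmul_continuousl g; apply; exact: oU.
by apply/seteqP; split=> h /=; rewrite flag_actM.
Qed.

Lemma continuous_flag_proj Th : continuous (flag_proj (R := R) Th).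
Proof.
apply/continuousP => U /flag_openP oU; apply/flag_openP => V.
rewrite [X in open X](_ : _ = [set h | U (flag_act h (flag_proj Th V))]); first exact: oU.
by apply/seteqP; split=> h /=; rewrite flag_proj_act.
Qed.

Lemma closure_image (T U : topologicalType) (f : T -> U) (A : set T) :
  continuous f -> f @` closure A `<=` closure (f @` A).
Proof.
move=> fc _ [x Ax <-] B /fc/Ax[y [Ay By]]; exists (f y); split=> //.
Qed.
End Topology.
End Flags.

(** * Dynamics of a regular element *)

Section Dynamics.
Context {R : realType} {n : nat}.
Notation G := (SL R n.+1).
Notation TT := [set: ThetaM n.+1]%SET.
Notation b0 Th := (@std_flag R n.+1 Th).

Lemma nbhs_SL (g : G) (U : set G) : nbhs g U ->
  exists2 C : set 'M[R]_n.+1, nbhs (slval g) C & forall x : G, C (slval x) -> U x.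
Proof.
rewrite nbhsE => -[B [[C oC eC] Bg] BU].
exists C; first by apply: open_nbhs_nbhs; split=> //; rewrite -eC in Bg.
by move=> x Cx; apply: BU; rewrite -eC.
Qed.

Lemma cvg_scale_mx (T : Type) (F : set_system T) (FF : Filter F) (f : T -> R) (a : R) :
  f @ F --> a -> (fun t => scale_mx n (f t)) @ F --> scale_mx n a.
Proof.
move=> fa; apply/cvg_mxP => i j.
have E c : scale_mx n c i j = (if i == 0 then c else 1) * (i == j)%:R.
  by rewrite !mxE mulr_natr.
rewrite E; under eq_cvg do rewrite E; apply: cvgM; last exact: cvg_cst.
by case: (i == 0); [exact: fa|exact: cvg_cst].
Qed.

Lemma scale_mx1 : scale_mx n (1 : R) = 1%:M.
Proof. by apply/matrixP => i j; rewrite !mxE if_same. Qed.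

(** [M + t N = (M N^-1 + t) N], and the first factor has an LU factorization for small nonzero [t].
    [N] = 1 serves to reach the open Bruhat cell, and [N] a transposition a cell of codimension
    one. *)
Lemma perturb_LU (M N : G) (U : set G) : nbhs M U ->
  exists t c (L K : G) V, [/\ U K, unitlower (slval L), upper V,
    slval K = (slval M + t *: slval N) *m scale_mx n c
    & slval M + t *: slval N = slval L *m V *m slval N].
Proof.
move=> /nbhs_SL[C nC CU]; pose Mt (t : R) := slval M + t *: slval N.
have MtE t : Mt t = (slval M *m invmx (slval N) + t%:M) *m slval N.
  by rewrite mulmxDl mulmxKV ?SL_unitmx // mul_scalar_mx.
have Mc : Mt @ (0 : R) --> slval M.
  have -> : slval M = slval M + 0 *: slval N by rewrite scale0r addr0.
  by apply: cvg_addmx; [exact: cvg_cst|apply: cvg_scalemx; exact: cvg_id].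
have Dc : (fun t => (\det (Mt t))^-1) @ (0 : R) --> (1 : R).
  have -> : (1 : R) = (\det (slval M))^-1 by rewrite SL_det invr1.
  by apply: cvgV; [rewrite SL_det oner_neq0|exact: cvg_det].
have Kc : (fun t => Mt t *m scale_mx n (\det (Mt t))^-1) @ (0 : R) --> slval M.
  have -> : slval M = slval M *m scale_mx n 1 by rewrite scale_mx1 mulmx1.
  by apply: cvg_mulmx => //; exact: cvg_scale_mx.
have nK := nbhs_dnbhs (Kc _ nC).
have nLU := near_LU (slval M *m invmx (slval N)).
have nD := near_det_neq0 (slval M *m invmx (slval N)).
near (0 : R)^' => t.
have [L [V [eLV lL uV]]] : exists L V, [/\ slval M *m invmx (slval N) + t%:M = L *m V,
   unitlower L & upper V] by near: t.
have D0 : \det (Mt t) != 0.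
  by rewrite MtE det_mulmx SL_det mulr1; near: t.
have /eqP dK := det_mul_scale D0.
have /eqP dL := unitlower_det lL.
exists t, (\det (Mt t))^-1, (MkSL dL), (MkSL dK), V; split => //=.
  by apply: CU => /=; near: t.
by rewrite -eLV -MtE.
Unshelve. all: by end_near. Qed.

Lemma upper_parabolic (Th : {set ThetaM n.+1}) (p : 'M[R]_n.+1) :
  upper p -> parabolic Th p.
Proof. by move=> up r _ i j jr ri; apply: up; exact: leq_trans ri. Qed.

Lemma stab_upper Th (p : G) : upper (slval p) -> flag_act p (b0 Th) = b0 Th.
Proof. by move=> up; apply/stab_std_flag; exact: upper_parabolic. Qed.

Lemma unitlower_upper_act Th (L K X : G) V (t c : R) :
  upper V -> slval K = (slval X + t *: slval (1%g : G)) *m scale_mx n c ->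
  slval X + t *: slval (1%g : G) = slval L *m V *m slval (1%g : G) ->
  upper (slval (L^-1 * K)%g) /\ flag_act K (b0 Th) = flag_act L (b0 Th).
Proof.
move=> uV eK eX.
have uLK : upper (slval (L^-1 * K)%g).
  have -> : slval (L^-1 * K)%g = V *m scale_mx n c.
    by rewrite /= eK eX /= mulmx1 -mulmxA mulKmx ?SL_unitmx.
  by apply: upperM => //; exact: upper_scale_mx.
by split=> //; rewrite -{1}(mulVKg L K) flag_actM stab_upper.
Qed.

(** * Orbit closures and invariant control sets *)

Section Regular.
Context (S : set G) (h P : G) (lam : 'rV[R]_n.+1).
Context (sS : is_semigroup S) (S0 : S° !=set0) (Sh : S h).
Context (lamd : forall i j : 'I_n.+1, (i < j)%N -> `|lam 0 j| < `|lam 0 i|).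
Context (hP : slval h *m slval P = slval P *m diag_mx lam).

Let D : G := (P^-1 * h * P)%g.
Notation b Th := (flag_act P (b0 Th)).

Lemma slvalD : slval D = diag_mx lam.
Proof. by rewrite /= -mulmxA hP mulKmx ?SL_unitmx. Qed.

Lemma slvalDX m : slval (D ^+ m)%g = diag_mx (\row_i lam 0 i ^+ m).
Proof.
elim: m => [|m IHm].
  by rewrite expg0; apply/matrixP => i j; rewrite !mxE expr0.
rewrite expgS [LHS]/= -/(slval D) -[X in X *m _]/(slval D) slvalD IHm mulmx_diag.
by congr diag_mx; apply/rowP => i; rewrite !mxE exprS.
Qed.

Lemma hXP m : (h ^+ m * P = P * D ^+ m)%g.
Proof.
elim: m => [|m IHm]; first by rewrite !expg0 mulg1 mul1g.
by rewrite !expgS -mulgA IHm /D !mulgA mulgV mul1g.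
Qed.

Lemma lam_neq0 i : lam 0 i != 0.
Proof.
have := SL_det D; rewrite slvalD det_diag => e.
by apply/eqP => l0; move/eqP: e; rewrite (bigD1 i) //= l0 mul0r eq_sym oner_eq0.
Qed.

(** The action of the m-th power of [h] near [b], in the eigenbasis [P]: entries below the diagonal
    are contracted, those above are expanded. *)
Definition conjD m (X : G) : G := (D ^+ m * X * (D ^+ m)^-1)%g.

Lemma conjDE m X i j : slval (conjD m X) i j = (lam 0 i / lam 0 j) ^+ m * slval X i j.
Proof.
have : slval (conjD m X) *m slval (D ^+ m)%g = slval (D ^+ m)%g *m slval X.
  exact: (congr1 (@slval _ _) (mulgVK (D ^+ m)%g (D ^+ m * X)%g)).
rewrite slvalDX mul_mx_diag mul_diag_mx => /matrixP/(_ i j).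
move: (slval (conjD m X)) (slval X) => A B; rewrite !mxE => e.
have lj : lam 0 j ^+ m != 0 by rewrite expf_neq0 // lam_neq0.
by apply: (mulIf lj); rewrite e expr_div_n; field.
Qed.

Lemma lam_ratio_cvg (i j : 'I_n.+1) : (i < j)%N ->
  (fun m => (lam 0 j / lam 0 i) ^+ m) @ \oo --> (0 : R).
Proof.
move=> ij; apply: cvg_expr; rewrite normrM normfV ltr_pdivrMr ?mul1r ?lamd //.
by rewrite normr_gt0 lam_neq0.
Qed.

Lemma conjD_cvg (L : G) : unitlower (slval L) -> conjD^~ L @ \oo --> (1%g : G).
Proof.
move=> lL; apply: cvg_SL; apply/cvg_mxP => i j.
rewrite (eq_cvg _ _ (fun m => conjDE m L i j)).
have -> : slval (1%g : G) i j = (i == j)%:R by rewrite mxE.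
have [ij|ji] := leqP i j.
  rewrite lL //; have [->|_] := eqVneq i j.
    by rewrite divff ?lam_neq0 //; under eq_cvg do rewrite expr1n mulr1; exact: cvg_cst.
  by under eq_cvg do rewrite mulr0; exact: cvg_cst.
have -> : (i == j)%:R = 0 * slval L i j by rewrite mul0r -val_eqE gtn_eqF.
by apply: cvgM; [exact: lam_ratio_cvg|exact: cvg_cst].
Qed.

Lemma stab_DX Th m : flag_act (D ^+ m)%g (b0 Th) = b0 Th.
Proof.
apply: stab_upper => i j ji; rewrite slvalDX mxE -val_eqE /= gtn_eqF //.
Qed.

Lemma semigroupX m g : S g -> S (h ^+ m * g)%g.
Proof.
move=> Sg; elim: m => [|m IHm]; first by rewrite expg0 mul1g.
by rewrite expgS -mulgA; exact: sS.
Qed.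

(** Some element of [S] close to [g0] maps [V] into the open cell [P L b0] with [L] unit lower
    triangular; the powers of [h] then contract [L] to 1, so the images converge to [b]. *)
Lemma attractor_closure Th (V : flag R Th) :
  closure [set flag_act g V | g in S] (b Th).
Proof.
have [X ->] := flag_transitive V; have [g0 Sg0] := S0.
have [y ey] : exists y, g0 = (P * y * X^-1)%g.
  by exists (P^-1 * g0 * X)%g; rewrite !mulgA mulgV mul1g mulgK.
have nU : nbhs y [set M | S (P * M * X^-1)%g].
  have FF := @nbhs_filter G y.
  have c : (fun M => P * M * X^-1)%g @ nbhs y --> g0.
    rewrite ey; apply: (@cvg_slmul _ _ _ FF _ (fun M => P * M)%g (fun=> (X^-1)%g));
      last exact: cvg_cst.
    by apply: (@cvg_slmul _ _ _ FF _ (fun=> P) id); [exact: cvg_cst|exact: cvg_id].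
  exact: (c S Sg0).
have [t [c [L [K [V' [UK lL uV' eK eX]]]]]] := perturb_LU 1%g nU.
have [_ KL] := unitlower_upper_act Th uV' eK eX.
have c1 : (fun m => flag_act (P * conjD m L)%g (b0 Th)) @ \oo --> b Th.
  apply: (@continuous_cvg _ _ _ _ _ (fun m => (P * conjD m L)%g) (fun g => flag_act g (b0 Th))).
    exact: continuous_flag_actl.
  rewrite -[X in _ --> X]mulg1; apply: cvg_slmul; first exact: cvg_cst.
  exact: conjD_cvg.
move=> B nB; have [m _ /(_ m (leqnn m)) Bm] := c1 B nB.
exists (flag_act (P * conjD m L)%g (b0 Th)); split=> //.
exists (h ^+ m * (P * K * X^-1))%g; first exact: semigroupX.
have E1 : (h ^+ m * (P * K * X^-1) * X = P * D ^+ m * K)%g.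
  by rewrite -mulgA mulgVK mulgA hXP.
rewrite -flag_actM E1 flag_actM KL -flag_actM /conjD.
have -> : (P * D ^+ m * L = P * (D ^+ m * L * (D ^+ m)^-1) * D ^+ m)%g.
  by rewrite -[RHS]mulgA mulgVK mulgA.
by rewrite flag_actM stab_DX.
Qed.

Notation orbit V := [set flag_act g V | g in S].
Notation C Th := (closure (orbit (b Th))).

Lemma closure_orbit_sub Th (V W : flag R Th) :
  closure (orbit V) W -> closure (orbit W) `<=` closure (orbit V).
Proof.
move=> VW; rewrite [X in _ `<=` X](closure_id _).1; last exact: closed_closure.
apply: closure_subset => _ [g Sg <-].
have := @closure_image _ _ (flag_act g) (orbit V) (@continuous_flag_actr R n.+1 Th g).
move=> /(_ (flag_act g W)) H.
apply: (closure_subset _ (H _)); last by exists W.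
by move=> _ [_ [g' Sg' <-] <-]; exists (g * g')%g; [exact: sS|rewrite flag_actM].
Qed.

(** [b] lies in the closure of every orbit, hence in every nonempty set with the control
    property. *)
Lemma invariant_control_setE Th : invariant_control_set S (Th := Th) = C Th.
Proof.
have cC : control_property S (C Th).
  move=> V CV; apply/seteqP; split; first exact: closure_orbit_sub.
  by apply: closure_orbit_sub; exact: attractor_closure.
have iC : is_invariant_control_set S (C Th).
  split=> // D' cD' sD'; apply/esym; apply: cD'; apply: sD'.
  exact: attractor_closure.
have [cD mD] := xgetPex set0 (ex_intro _ _ iC).
rewrite /invariant_control_set; set E := xget _ _ in cD mD *.
(* The empty set has the control property; if [E] is empty, its maximality identifies it with the
   orbit closure of [b]. *)
have [[V EV]|E0] := pselect (E !=set0); last first.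
  by apply/esym; apply: mD => // V EV; case: E0; exists V.
have Eb : E (b Th) by rewrite -(cD V EV); exact: attractor_closure.
by rewrite -(cD _ Eb).
Qed.

Definition saturated (Th : {set ThetaM n.+1}) : Prop := forall X p : G,
  C TT (flag_act X (b0 TT)) ->
  parabolic Th (slval p) ->
  C TT (flag_act (X * p)%g (b0 TT)).

Lemma preimage_saturated Th :
  flag_proj Th @^-1` invariant_control_set S (Th := Th) =
    invariant_control_set S (Th := TT) <-> saturated Th.
Proof.
rewrite !invariant_control_setE; split=> [e X p|sat].
  rewrite -e /= => CX pp.
  have /stab_std_flag sp := pp.
  by move: CX; rewrite !flag_proj_act flag_proj_std flag_actM sp.
(* By saturation this image avoids that of [C TT]; it is open because its preimage under an orbit
   map is that of the complement of [C TT]. *)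
pose U := flag_proj Th @` ~` C TT.
have satU X : U (flag_act X (b0 Th)) ->
    ~ C TT (flag_act X (b0 TT)).
  case=> z; have [Z ->] := flag_transitive z => nCZ.
  rewrite flag_proj_act flag_proj_std => eZX CX; apply: nCZ.
  rewrite -(mulVKg X Z); apply: sat => //.
  by apply/stab_std_flag; rewrite flag_actM eZX -flag_actM mulVg flag_act1.
have oU : open U.
  apply/flag_openP => V; have [Y ->] := flag_transitive V.
  rewrite [X in open X](_ : _ =
    (fun g => flag_act g (flag_act Y (b0 TT))) @^-1` ~` C TT); last first.
    apply/seteqP; split=> g /=; rewrite -!flag_actM; first exact: satU.
    move=> nC; exists (flag_act (g * Y)%g (b0 TT)) => //.
    by rewrite flag_proj_act flag_proj_std.
  have /continuousP := @continuous_flag_actl R n.+1 _ (flag_act Y (b0 TT)).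
  by apply; apply: closed_openC; exact: closed_closure.
apply/seteqP; split=> x /=.
  move=> Cx; apply: contrapT => nCx.
  have Ux : U (flag_proj Th x) by exists x.
  have [_ [[g Sg <-] Ug]] := Cx U (open_nbhs_nbhs (conj oU Ux)).
  rewrite -flag_actM in Ug; apply: (satU _ Ug); apply: subset_closure.
  by exists g => //; rewrite flag_actM.
move=> Cx; have := @closure_image _ _ (flag_proj Th) _ (@continuous_flag_proj R n.+1 Th).
move=> /(_ (orbit (b TT)) (flag_proj Th x)) H.
apply: (closure_subset _ (H _)); last by exists x.
move=> _ [_ [g Sg <-] <-]; exists g => //.
by rewrite !flag_proj_act flag_proj_std.
Qed.

End Regular.
End Dynamics.

(** * Transvections and transpositions *)

Section Elementary.
Context {R : realType} {n : nat}.
Notation G := (SL R n.+1).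
Implicit Types (i j : 'I_n.+1) (a : R).

Lemma det_transvection i j a : i != j ->
  \det (1%:M + a *: delta_mx i j : 'M[R]_n.+1) = 1.
Proof.
move=> ij; have [ltij|leji] := ltnP i j.
  rewrite upper_det => [|i' j' ji'].
    rewrite big1 // => l _; rewrite !mxE eqxx.
    case: eqVneq => [->|]; last by rewrite mulr0 addr0.
    by rewrite (negbTE ij) mulr0 addr0.
  rewrite !mxE -val_eqE /= gtn_eqF //.
  case: eqVneq => [ei|_]; last by rewrite mulr0 addr0.
  case: eqVneq => [ej|_]; last by rewrite mulr0 addr0.
  by move: ji'; rewrite ei ej ltnNge ltnW.
apply: unitlower_det => i' j' ij'; rewrite !mxE.
case: (eqVneq i' i) => [ei|_]; last by rewrite mulr0 addr0.
case: (eqVneq j' j) => [ej|_]; last by rewrite mulr0 addr0.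
move: ij'; rewrite ei ej => ij'; move: ij; rewrite -val_eqE /=.
by rewrite eqn_leq ij' leji.
Qed.

(** The default value 1 can only occur for [i = j], where the determinant is [1 + a]. *)
Definition transvection i j a : G :=
  insubd (1%g : G) (1%:M + a *: delta_mx i j : 'M[R]_n.+1).

Lemma slval_transvection i j a : i != j ->
  slval (transvection i j a) = 1%:M + a *: delta_mx i j.
Proof. by move=> ij; rewrite val_insubd det_transvection ?eqxx. Qed.

Lemma transvectionD i j a a' : i != j ->
  transvection i j (a + a') = (transvection i j a * transvection i j a')%g.
Proof.
move=> ij; apply: val_inj; rewrite /= !slval_transvection //.
rewrite mulmxDl mul1mx mulmxDr mulmx1 -scalemxAl -scalemxAr mul_delta_mx_cond.
by rewrite eq_sym (negbTE ij) mulr0n !scaler0 addr0 scalerDl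
  [a *: _ + _]addrC addrA.
Qed.

Lemma transvection0 i j : transvection i j 0 = 1%g.
Proof.
apply: val_inj; rewrite /= /transvection val_insubd.
by rewrite scale0r addr0 det1 eqxx.
Qed.

Lemma transvectionV i j a : i != j ->
  ((transvection i j a)^-1 = transvection i j (- a))%g.
Proof.
move=> ij; apply: (mulgI (transvection i j a)).
by rewrite mulgV -transvectionD // subrr transvection0.
Qed.

Lemma mul_transvection i j a m (A : 'M[R]_(n.+1, m)) i' (j' : 'I_m) : i != j ->
  (slval (transvection i j a) *m A) i' j' = A i' j' + (if i' == i then a * A j j' else 0).
Proof.
move=> ij; rewrite slval_transvection // mulmxDl mul1mx -scalemxAl !mxE.
congr (_ + _); case: eqVneq => [->|ne].
  rewrite (bigD1 j) //= big1 => [|l lj]; rewrite !mxE !eqxx /= ?(negbTE lj) ?mul0r //.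
  by rewrite mul1r addr0.
by rewrite big1 ?mulr0 // => l _; rewrite mxE (negbTE ne) mul0r.
Qed.

Lemma cvg_transvection i j (T : Type) (F : set_system T) (FF : Filter F) (f : T -> R) a :
  i != j -> f @ F --> a -> (fun t => transvection i j (f t)) @ F --> transvection i j a.
Proof.
move=> ij fa; apply: cvg_SL; rewrite slval_transvection //.
rewrite (eq_cvg _ _ (fun t => slval_transvection (f t) ij)).
by apply: cvg_addmx; [exact: cvg_cst|exact: cvg_scalemx].
Qed.

(* The signed permutation matrix mapping e_i to e_j and e_j to - e_i. *)
Definition swap_sign j j' : R := if j' == j then -1 else 1.
Definition swap_mx i j : 'M[R]_n.+1 :=
  perm_mx (tperm i j) *m diag_mx (\row_j' swap_sign j j').

Lemma det_swap_mx i j : i != j -> \det (swap_mx i j) = 1.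
Proof.
move=> ij; rewrite det_mulmx det_perm odd_tperm ij det_diag (bigD1 j) //=.
rewrite big1 => [|l lj]; rewrite mxE /swap_sign ?eqxx ?(negbTE lj) //.
by rewrite expr1 mulr1 mulrNN mulr1.
Qed.

Definition swap i j : G := insubd (1%g : G) (swap_mx i j).

Lemma slval_swap i j : i != j -> slval (swap i j) = swap_mx i j.
Proof. by move=> ij; rewrite val_insubd det_swap_mx ?eqxx. Qed.

Lemma mulmx_swap i j (A : 'M[R]_n.+1) i' j' : i != j ->
  (A *m slval (swap i j)) i' j' = A i' (tperm i j j') * swap_sign j j'.
Proof.
move=> ij; rewrite slval_swap // /swap_mx mulmxA mul_mx_diag.
rewrite -tpermV -col_permE !mxE. by rewrite tpermV.
Qed.

Lemma swapV_mulmx i j (A : 'M[R]_n.+1) i' j' : i != j ->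
  (invmx (slval (swap i j)) *m A) i' j' = swap_sign j i' * A (tperm i j i') j'.
Proof.
move=> ij; pose B := \matrix_(i', j') (swap_sign j i' * A (tperm i j i') j').
suff eB : slval (swap i j) *m B = A.
  by rewrite -{1}eB mulKmx ?SL_unitmx // mxE.
rewrite slval_swap // /swap_mx -mulmxA mul_diag_mx -row_permE.
apply/matrixP => a b; rewrite !mxE tpermK mulrA /swap_sign.
by case: (_ == _); rewrite ?mulrNN !mul1r.
Qed.
End Elementary.

(** * Saturation along the k-th subspace *)

Section Fiber.
Context {R : realType} {n : nat}.
Notation G := (SL R n.+1).
Notation TT := [set: ThetaM n.+1]%SET.
Notation b0 Th := (@std_flag R n.+1 Th).

Context (S : set G) (h P : G) (lam : 'rV[R]_n.+1).
Context (sS : is_semigroup S) (S0 : S° !=set0) (Sh : S h).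
Context (lamd : forall i j : 'I_n.+1, (i < j)%N -> `|lam 0 j| < `|lam 0 i|).
Context (hP : slval h *m slval P = slval P *m diag_mx lam).
Notation orbit V := [set flag_act g V | g in S].
Notation b Th := (flag_act P (b0 Th)).

(* Some g in S maps a nonzero vector of the k-plane B <e_1, ..., e_k> into the
   complementary plane A^-1 <e_(k+1), ..., e_(n+1)>. *)
Definition degenerate (k : nat) : Prop := forall A B : G,
  exists g (c : 'cV[R]_n.+1), [/\ S g, c != 0,
    forall i : 'I_n.+1, (k <= i)%N -> c i 0 = 0
    & forall i : 'I_n.+1, (i < k)%N ->
        (slval A *m slval g *m slval B *m c) i 0 = 0].

Context (k : ThetaM n.+1).
(** Indices start at 0: [k0] = k - 1 is the last basis vector of the k-th standard subspace, [k1] =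
    k the first one outside it. *)
Let k1 : 'I_n.+1 := val k.
Let k0 : 'I_n.+1 := Ordinal (leq_ltn_trans (leq_pred k1) (ltn_ord k1)).

Let k0S : k0.+1 = k1. Proof. by rewrite /= prednK // (valP k). Qed.
Let kS : (k : nat) = k0.+1. Proof. exact: esym k0S. Qed.
Let k01 : k0 != k1. Proof. by rewrite -val_eqE /= -[X in _ != X]k0S /= neq_ltn ltnSn. Qed.

(* Coordinates, in the basis P, of the flags in the orbit of b. *)
Let T : set G := [set M | orbit (b TT) (flag_act (P * M)%g (b0 TT))].

Lemma interiorT_stab (M U : G) : flag_act U (b0 TT) = b0 TT -> T° M -> T° (M * U)%g.
Proof.
move=> sU TM; have FF := @nbhs_filter G (M * U)%g.
have sV : flag_act (U^-1)%g (b0 TT) = b0 TT.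
  by rewrite -{1}sU -flag_actM mulVg flag_act1.
have c : (fun X => X * U^-1)%g @ nbhs (M * U)%g --> M.
  have {2}-> : M = ((M * U) * U^-1)%g by rewrite mulgK.
  by apply: (@cvg_slmul _ _ _ FF _ id (fun=> (U^-1)%g)); [exact: cvg_id|exact: cvg_cst].
have := c T TM; apply: (@filterS _ _ FF) => X.
by rewrite /T /= mulgA [flag_act (_ * U^-1)%g _]flag_actM sV.
Qed.

(** Forward substitution. *)
Lemma unitlower_solve (L : 'M[R]_n.+1) m p (v : 'M[R]_(n.+1, m)) (j : 'I_m) :
  unitlower L -> (forall i : 'I_n.+1, (i < p)%N -> (L *m v) i j = 0) ->
  forall i : 'I_n.+1, (i < p)%N -> v i j = 0.
Proof.
move=> lL Lv [i ilt]; elim/ltn_ind: i ilt => i IHi ilt /= ip.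
have := Lv (Ordinal ilt) ip; rewrite mxE (bigD1 (Ordinal ilt)) //= big1.
  by rewrite lL // eqxx mul1r addr0.
move=> [l llt]; rewrite -val_eqE /= => li.
have [ltli|leil] := ltnP l i; first by rewrite IHi ?mulr0 // (ltn_trans ltli).
by rewrite lL //= -val_eqE /= eq_sym (negbTE li) mul0r.
Qed.

Lemma degenerate_cell : degenerate k -> exists2 L : G,
  unitlower (slval L) & T° (L * swap k0 k1)%g.
Proof.
move=> deg; have [g0 Sg0] := S0.
(* As [g0] is interior to [S], so is [g0 * g], and [M1] is interior to [T]. *)
have [g [c [Sg cn0 ck cM]]] := deg (P^-1 * g0)%g P.
pose M1 : G := (P^-1 * g0 * g * P)%g.
have TM1 : T° M1.
  have FF := @nbhs_filter G M1.
  have cc : (fun M => P * M * P^-1)%g @ nbhs M1 --> (g0 * g)%g.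
    have -> : (g0 * g = P * M1 * P^-1)%g by rewrite /M1 !mulgA mulgV mul1g mulgK.
    apply: (@cvg_slmul _ _ _ FF _ (fun M => P * M)%g (fun=> (P^-1)%g));
      last exact: cvg_cst.
    by apply: (@cvg_slmul _ _ _ FF _ (fun=> P) id); [exact: cvg_cst|exact: cvg_id].
  have := cc S (semigroup_interiorM sS Sg0 Sg).
  apply: (@filterS _ _ FF) => X SX; exists (P * X * P^-1)%g => //.
  by rewrite -flag_actM mulgVK.
have {}cM : forall i : 'I_n.+1, (i < k)%N -> (slval M1 *m c) i 0 = 0 by exact: cM.
(* A perturbation makes the last coordinate of c nonzero, so that c can become
   a column of the matrix without changing the flag. *)
have [M2 [c2 [TM2 c2k0 c2k c2M]]] : exists (M2 : G) (c2 : 'cV[R]_n.+1),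
  [/\ T° M2, c2 k0 0 = 1, forall i : 'I_n.+1, (k <= i)%N -> c2 i 0 = 0
   & forall i : 'I_n.+1, (i < k)%N -> (slval M2 *m c2) i 0 = 0].
  suff [M2 [c2 [TM2 c2k0 c2k c2M]]] : exists (M2 : G) (c2 : 'cV[R]_n.+1),
    [/\ T° M2, c2 k0 0 != 0, forall i : 'I_n.+1, (k <= i)%N -> c2 i 0 = 0
     & forall i : 'I_n.+1, (i < k)%N -> (slval M2 *m c2) i 0 = 0].
    exists M2, ((c2 k0 0)^-1 *: c2); split=> // [|i ki|i ik].
    - by rewrite mxE mulVf.
    - by rewrite mxE (c2k i ki) mulr0.
    - by rewrite -scalemxAr mxE (c2M i ik) mulr0.
  have [ck0|ck0] := eqVneq (c k0 0) 0; last by exists M1, c.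
  have [i0 ci0] : exists i, c i 0 != 0.
    apply/existsP; apply: contraNT cn0; rewrite negb_exists => /forallP H.
    by apply/eqP/colP => i; rewrite [RHS]mxE; apply/eqP; exact: negbNE (H i).
  have k0i0 : k0 != i0 by apply: contraNneq ci0 => <-; rewrite ck0.
  have FF := @dnbhs_filter R 0.
  have cv : (fun e : R => M1 * transvection k0 i0 (- e))%g @ (0 : R) --> M1.
    have {2}-> : M1 = (M1 * transvection k0 i0 (- 0))%g by rewrite oppr0 transvection0 mulg1.
    apply: (@cvg_slmul _ _ _ _ _ (fun=> M1) (fun e => transvection k0 i0 (- e)));
      first exact: cvg_cst.
    by apply: cvg_transvection => //; apply: cvgN; exact: cvg_id.
  have nT := nbhs_dnbhs (cv _ (nbhs_interior TM1)).
  near (0 : R)^' => e.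
  have e0 : e != 0 by near: e; exact: nbhs_dnbhs_neq.
  exists (M1 * transvection k0 i0 (- e))%g, (slval (transvection k0 i0 e) *m c).
  split.
  - by near: e.
  - by rewrite mul_transvection // eqxx ck0 add0r mulf_neq0.
  - move=> i ki; rewrite mul_transvection // ck // add0r -val_eqE /= gtn_eqF //.
    by rewrite -ltnS k0S.
  - move=> i ik; rewrite -transvectionV // [slval (_ * _)%g]/= mulmxA.
    rewrite -(mulmxA (slval M1)) mulVmx ?SL_unitmx // mulmx1.
    exact: cM.
pose U : 'M[R]_n.+1 := \matrix_(i, j) if j == k0 then c2 i 0 else (i == j)%:R.
have uU : upper U.
  move=> i j ji; rewrite mxE; case: eqVneq => [jk0|_].
    by rewrite c2k // kS -jk0.
  by rewrite -val_eqE /= gtn_eqF.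
have dU : \det U == 1.
  by rewrite upper_det // big1 // => i _; rewrite mxE eqxx; case: eqVneq => // ->.
pose M3 : G := (M2 * MkSL dU)%g.
have TM3 : T° M3 by apply: interiorT_stab => //; exact: stab_upper.
have M3k0 (i : 'I_n.+1) : (i < k)%N -> slval M3 i k0 = 0.
  move=> ik; rewrite -[RHS](c2M i ik) [LHS]mxE [RHS]mxE.
  by apply: eq_bigr => l _; rewrite [in LHS]mxE eqxx.
have [t [s [L [K [V [TK lL uV eK eX]]]]]] := perturb_LU (swap k0 k1) (nbhs_interior TM3).
exists L => //.
(* Column [k0] of [M3] vanishes above row [k], and that of the transposition is the basis vector of
   index [k1]. So column [k1] of [L *m V] vanishes there, and so does that of [V]. *)
have Vk : V k0 k1 = 0.
  apply: (@unitlower_solve (slval L) _ k1) => //; last by rewrite (leq_trans (ltnSn k0)) // k0S.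
  move=> i ik.
  have := congr1 (fun A : 'M[R]_n.+1 => A i k0) eX.
  rewrite mulmx_swap // tpermL /swap_sign (negbTE k01) mulr1 => <-.
  rewrite mxE [X in _ + X]mxE M3k0 // -(mul1mx (slval (swap _ _))) mulmx_swap //.
  by rewrite tpermL mxE -val_eqE /= ltn_eqF // mul0r mulr0 addr0.
(* Conjugating an upper triangular [V] by the transposition of [k0] and [k1] can only create the
   entry [V k0 k1] below the diagonal, and it is 0. *)
have uW : upper (slval ((L * swap k0 k1)^-1 * K)%g).
  have -> : slval ((L * swap k0 k1)^-1 * K)%g =
      (invmx (slval (swap k0 k1)) *m (V *m slval (swap k0 k1))) *m scale_mx n s.
    rewrite invgM [LHS]/= eK eX -!mulmxA; congr (_ *m _).
    by rewrite mulKmx ?SL_unitmx.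
  apply: upperM; last exact: upper_scale_mx.
  move=> i j ji; rewrite swapV_mulmx // mulmx_swap //.
  suff -> : V (tperm k0 k1 i) (tperm k0 k1 j) = 0 by rewrite mul0r mulr0.
  case: tpermP => [ei|ei|/eqP ni0 /eqP ni1]; case: tpermP => [ej|ej|/eqP nj0 /eqP nj1].
  - by move: ji; rewrite ei ej ltnn.
  - by move: ji; rewrite ei ej -k0S ltnNge leqnSn.
  - by apply: uV; rewrite (ltn_trans ji) // ei -k0S.
  - by [].
  - by move: ji; rewrite ei ej ltnn.
  - apply: uV; move: ji; rewrite ei -k0S ltnS leq_eqVlt => /orP[/eqP/val_inj e|//].
    by move: nj0; rewrite e eqxx.
  - apply: uV; move: ji; rewrite ej => k0i; rewrite ltn_neqAle -k0S k0i andbT.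
    by rewrite k0S eq_sym; apply: contra ni1 => /eqP/val_inj ->.
  - by apply: uV; rewrite (leq_trans _ ji) // ltnS ej -k0S.
  - exact: uV.
rewrite -(mulgK ((L * swap k0 k1)^-1 * K)%g (L * swap k0 k1)%g) mulVKg.
apply: interiorT_stab => //.
by rewrite -{1}(stab_upper TT uW) -flag_actM mulVg flag_act1.
Unshelve. all: by end_near. Qed.

Notation CT := (closure (orbit (b TT))).

Lemma conjDM m (X Y : G) : (conjD h P m (X * Y) = conjD h P m X * conjD h P m Y)%g.
Proof. by rewrite /conjD !mulgA mulgVK. Qed.

Lemma act_conjD m (X : G) :
  flag_act (P * (P^-1 * h * P) ^+ m * X)%g (b0 TT) = flag_act (P * conjD h P m X)%g (b0 TT).
Proof.
have -> : (P * (P^-1 * h * P) ^+ m * X = P * conjD h P m X * (P^-1 * h * P) ^+ m)%g.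
  by rewrite /conjD -!mulgA mulVg mulg1.
by rewrite flag_actM (stab_DX hP).
Qed.

(** As [a] varies, these flags fill the fiber through [b] over the flags without their k-th
    subspace, except [b] itself. *)
Lemma fiber_curve (L : G) (a : R) : unitlower (slval L) -> T° (L * swap k0 k1)%g ->
  CT (flag_act (P * (transvection k0 k1 a * swap k0 k1))%g (b0 TT)).
Proof.
move=> lL TL; have k0k1 : (k0 < k1)%N by rewrite (leq_trans (ltnSn k0)) // k0S.
(* Chosen so that [conjD] expands the parameter back to exactly [a], while [e m] tends to 0 and
   keeps the curve in the neighbourhood [T]. *)
pose e m := a * (lam 0 k1 / lam 0 k0) ^+ m.
have ec : e @ \oo --> (0 : R).
  rewrite -(mulr0 a); apply: cvgM; first exact: cvg_cst.
  exact: (lam_ratio_cvg lamd hP).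
have sw m : flag_act ((conjD h P m (swap k0 k1)))%g (b0 TT) =
    flag_act (swap k0 k1) (b0 TT).
  rewrite -(mulVKg (swap k0 k1) (conjD _ _ _ _)) flag_actM stab_upper //.
  move=> i j ji; rewrite [slval _]/= swapV_mulmx // (conjDE hP).
  rewrite -(mul1mx (slval (swap k0 k1))) mulmx_swap // mxE (inj_eq perm_inj).
  by rewrite -val_eqE /= gtn_eqF // mul0r !mulr0.
have nT : \forall m \near \oo, T (L * (transvection k0 k1 (e m) * swap k0 k1))%g.
  have c : (fun m => L * (transvection k0 k1 (e m) * swap k0 k1))%g @ \oo -->
      (L * swap k0 k1)%g.
    apply: (@cvg_slmul _ _ _ _ _ (fun=> L) (fun m => transvection k0 k1 (e m) * swap k0 k1)%g);
      first exact: cvg_cst.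
    rewrite -[X in _ --> X]mul1g -(transvection0 k0 k1).
    apply: (@cvg_slmul _ _ _ _ _ (fun m => transvection k0 k1 (e m)) (fun=> swap k0 k1));
      last exact: cvg_cst.
    exact: cvg_transvection.
  exact: c.
have conjT m : conjD h P m (transvection k0 k1 (e m)) = transvection k0 k1 a.
  apply: val_inj; apply/matrixP => i j.
  rewrite (conjDE hP) -[RHS]/(slval (transvection k0 k1 a) i j) !slval_transvection //.
  rewrite !mxE; have [<-|ij] := eqVneq i j.
    rewrite divff ?(lam_neq0 hP) // expr1n mul1r.
    have -> : (i == k0) && (i == k1) = false.
      by apply/negbTE/negP => /andP[/eqP -> /eqP]; apply/eqP.
    by rewrite mulr0n !mulr0.
  have [->|_] := eqVneq i k0; last by rewrite /= !mulr0n !mulr0 addr0 mulr0.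
  have [->|_] := eqVneq j k1; last by rewrite /= !mulr0n !mulr0 addr0 mulr0.
  rewrite /e /= mulr0n mulr1n !add0r !mulr1 mulrCA -exprMn mulrA divfK ?(lam_neq0 hP) //.
  by rewrite divff ?(lam_neq0 hP) // expr1n mulr1.
have cP : (fun m => flag_act
      (P * (conjD h P m L * (transvection k0 k1 a * swap k0 k1)))%g (b0 TT)) @ \oo
    --> flag_act (P * (transvection k0 k1 a * swap k0 k1))%g (b0 TT).
  apply: (@continuous_cvg _ _ _ _ _
    (fun m => (P * (conjD h P m L * (transvection k0 k1 a * swap k0 k1)))%g)
    (fun g => flag_act g (b0 TT))); first exact: continuous_flag_actl.
  apply: (@cvg_slmul _ _ _ _ _ (fun=> P)); first exact: cvg_cst.
  rewrite -[X in _ --> X]mul1g.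
  apply: (@cvg_slmul _ _ _ _ _ (conjD h P ^~ L)); last exact: cvg_cst.
  exact: (conjD_cvg lamd hP).
move=> B /cP nB.
have [m [Tm Bm]] : exists m, T (L * (transvection k0 k1 (e m) * swap k0 k1))%g /\
   B (flag_act (P * (conjD h P m L * (transvection k0 k1 a * swap k0 k1)))%g (b0 TT)).
  exact: (filter_ex (filterI nT nB)).
exists (flag_act (P * (conjD h P m L * (transvection k0 k1 a * swap k0 k1)))%g (b0 TT)).
split=> //; have [g Sg eg] := Tm.
exists (h ^+ m * g)%g; first exact: semigroupX.
transitivity (flag_act (h ^+ m)%g (flag_act g (b TT))); first exact: flag_actM.
rewrite eg -flag_actM mulgA hXP act_conjD !conjDM conjT.
transitivity (flag_act (P * conjD h P m L * transvection k0 k1 a)%g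
  (flag_act (conjD h P m (swap k0 k1)) (b0 TT))); first by rewrite -flag_actM !mulgA.
by rewrite sw -flag_actM !mulgA.
Qed.

Lemma fiber_closure (q : G) : degenerate k ->
  parabolic (TT :\ k)%SET (slval q) -> CT (flag_act (P * q)%g (b0 TT)).
Proof.
move=> /degenerate_cell[L lL TL] pq.
(* The only possible nonzero entry of [q] below the diagonal is at [k1], [k0]. If it is 0, then [q]
   fixes the standard flag. *)
have qE (i j : 'I_n.+1) : (j < i)%N -> (i != k1) || (j != k0) -> slval q i j = 0.
  move=> ji; have [jk0 /= ik1|jk0 _] := eqVneq j k0; last first.
    have j0 : (0 < j.+1)%N by [].
    have jn : (j.+1 < n.+1)%N by rewrite (leq_ltn_trans ji).
    apply: (pq (exist _ (Ordinal jn) j0)) => //.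
    rewrite !inE andbT -val_eqE -val_eqE /=.
    by apply: contra jk0 => /eqP e; rewrite -val_eqE /= -e.
  rewrite orbF in ik1.
  have k1i : (k0.+1 < i)%N.
    have : (k0 < i)%N by rewrite -jk0.
    rewrite leq_eqVlt => /orP[/eqP e|//]; case/eqP: ik1; apply: val_inj.
    exact: (etrans (esym e) k0S).
  have kn : (k0.+2 < n.+1)%N by rewrite (leq_ltn_trans k1i).
  apply: (pq (exist _ (Ordinal kn) (ltn0Sn _))) => //; last by rewrite jk0 /= ltnW.
  by rewrite !inE andbT -val_eqE -val_eqE /= -/(rk k) kS gtn_eqF.
have [q0|q0] := eqVneq (slval q k1 k0) 0.
  have uq : upper (slval q).
    move=> i j ji; have [ik|ik] := eqVneq i k1; last by rewrite qE // ik.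
    have [jk|jk] := eqVneq j k0; last by rewrite qE // jk orbT.
    by rewrite ik jk.
  rewrite flag_actM (stab_upper TT uq); exact: (attractor_closure sS S0 Sh lamd hP).
(* The affine coordinate of the line spanned by column [k0] of [q] modulo the first [k0] basis
   vectors. *)
pose a := slval q k0 k0 / slval q k1 k0.
pose U : G := ((transvection k0 k1 a * swap k0 k1)^-1 * q)%g.
have uU : upper (slval U).
  rewrite /U invgM transvectionV // => i j ji.
  rewrite [slval _]/= -mulmxA swapV_mulmx // mul_transvection //.
  suff -> : slval q (tperm k0 k1 i) j +
    (if tperm k0 k1 i == k0 then - a * slval q k1 j else 0) = 0 by rewrite mulr0.
  case: tpermP => [ei|ei|/eqP ni0 /eqP ni1].
  - have jk0 : j != k0 by rewrite -val_eqE /= ltn_eqF // -[X in (_ < X)%N]/(val k0) -ei.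
    by rewrite eq_sym (negbTE k01) addr0 qE ?jk0 ?orbT // (ltn_trans ji) // ei -k0S.
  - rewrite eqxx; have [->|jk0] := eqVneq j k0.
      by rewrite /a mulNr divfK // subrr.
    have jltk0 : (j < k0)%N.
      by move: ji; rewrite ei -k0S ltnS leq_eqVlt => /orP[/eqP/val_inj e|//]; rewrite e eqxx in jk0.
    rewrite !qE ?k01 ?jk0 ?orbT ?mulr0 ?addr0 //.
    by rewrite (ltn_trans jltk0) // -k0S.
  - by rewrite (negbTE ni0) addr0 qE // ni1.
have -> : (P * q = P * (transvection k0 k1 a * swap k0 k1) * U)%g.
  by rewrite /U -mulgA mulVKg.
rewrite flag_actM (stab_upper TT uU); exact: fiber_curve lL TL.
Qed.

Lemma parabolic_change Th (X Y q : G) : flag_act X (b0 TT) = flag_act Y (b0 TT) ->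
  parabolic Th (slval q) -> parabolic Th (slval (X^-1 * (Y * q))%g).
Proof.
move=> eXY /stab_std_flag pq; apply/stab_std_flag.
rewrite mulgA flag_actM pq; apply/stab_std_flag.
have /stab_std_flag pXY : flag_act (X^-1 * Y)%g (b0 TT) = b0 TT.
  by rewrite flag_actM -eXY -flag_actM mulVg flag_act1.
by move=> r _; apply: pXY; rewrite inE.
Qed.

(** The set [A] of flags whose translates by the parabolic subgroup all lie in [CT] contains [b], is
    closed and is stable by [S]; so it contains [CT]. *)
Lemma saturated_degenerate : degenerate k -> saturated S P (TT :\ k)%SET.
Proof.
move=> deg.
pose A : set (flag R TT) := [set V | forall X q : G, V = flag_act X (b0 TT) ->
  parabolic (TT :\ k)%SET (slval q) -> CT (flag_act (X * q)%g (b0 TT))].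
have Ab : A (b TT).
  move=> X q eX pq; rewrite -(mulVKg P (X * q)%g); apply: fiber_closure => //.
  exact: parabolic_change.
have cA : closed A.
  rewrite -openC; apply/flag_openP => V; have [Y ->] := flag_transitive V.
  rewrite [X in open X](_ : _ =
    \bigcup_(q in [set q : G | parabolic (TT :\ k)%SET (slval q)])
      (fun g => flag_act g (flag_act (Y * q)%g (b0 TT))) @^-1` ~` CT).
    apply: bigcup_open => q _.
    have /continuousP := @continuous_flag_actl R n.+1 _ (flag_act (Y * q)%g (b0 TT)).
    by apply; apply: closed_openC; exact: closed_closure.
  apply/seteqP; split=> g /=; rewrite -flag_actM.
    move=> nA; apply: contrapT => nq; apply: nA => X q eX pq; apply: contrapT => nC.
    apply: nq; exists ((g * Y)^-1 * (X * q))%g; first exact: parabolic_change.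
    by rewrite /= -flag_actM mulgA mulVKg.
  case=> q /= pq nC AY; apply: nC; rewrite -flag_actM mulgA.
  exact: AY.
have SA V g : S g -> A V -> A (flag_act g V).
  move=> Sg AV X q eX pq.
  have CV : CT (flag_act (g^-1 * X * q)%g (b0 TT)).
    by apply: AV => //; rewrite flag_actM -eX -flag_actM mulVg flag_act1.
  apply: (closure_orbit_sub sS CV); apply: subset_closure.
  by exists g => //; rewrite -flag_actM !mulgA mulgV mul1g.
move=> X p CX pp; suff : A (flag_act X (b0 TT)) by move=> /(_ X p); apply.
apply: cA; apply: (closure_subset _ CX) => _ [g Sg <-].
exact: SA.
Qed.
End Fiber.

(** * Generation of the parabolic subgroup *)

Section Gallery.
Context {R : realType} {n : nat}.
Notation G := (SL R n.+1).
Notation TT := [set: ThetaM n.+1]%SET.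
Notation b0 Th := (@std_flag R n.+1 Th).

Lemma transvection_commutator (i l j : 'I_n.+1) (a c : R) :
  i != l -> l != j -> i != j ->
  (transvection i j (a * c) = transvection i l a * transvection l j c *
     transvection i l (- a) * transvection l j (- c))%g.
Proof.
move=> il lj ij; rewrite -!transvectionV //.
apply: (mulIg (transvection l j c)); rewrite mulgVK.
apply: (mulIg (transvection i l a)); rewrite mulgVK.
apply: val_inj; rewrite /= !slval_transvection //.
rewrite !(mulmxDl, mulmxDr) !mulmx1 !mul1mx -!scalemxAl -!scalemxAr.
have [/negbTE ij' /negbTE lj'] : j != i /\ j != l by rewrite ![j == _]eq_sym.
rewrite !mul_delta_mx_cond ij' lj' !eqxx !mulr0n mulr1n !scaler0 !(mul0mx, scaler0) !addr0.
rewrite ?scalerA.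
by apply/matrixP => x y; rewrite !mxE; ring.
Qed.

Context (A : set (flag R TT)) (cA : closed A).

(** The right translations preserving the set of [X] with [X b0] in [A]. *)
Let N : set G := [set p | forall X : G,
  A (flag_act X (b0 TT)) -> A (flag_act (X * p)%g (b0 TT))].

Let N1 : N 1%g. Proof. by move=> X; rewrite mulg1. Qed.

Let NM p q : N p -> N q -> N (p * q)%g.
Proof. by move=> Np Nq X AX; rewrite mulgA; apply/Nq/Np. Qed.

Lemma parabolicM Th (p q : G) : parabolic Th (slval p) -> parabolic Th (slval q) ->
  parabolic Th (slval (p * q)%g).
Proof.
move=> /stab_std_flag sp /stab_std_flag sq; apply/stab_std_flag.
by rewrite flag_actM sq.
Qed.

Lemma parabolicV Th (p : G) : parabolic Th (slval p) -> parabolic Th (slval (p^-1)%g).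
Proof.
move=> /stab_std_flag sp; apply/stab_std_flag.
by rewrite -{1}sp -flag_actM mulVg flag_act1.
Qed.

Context (Th : {set ThetaM n.+1}) (k : ThetaM n.+1).
Context (NTh : forall p : G, parabolic Th (slval p) -> N p).
Context (Nk : forall p : G, parabolic (TT :\ k)%SET (slval p) -> N p).

Let k1 : 'I_n.+1 := val k.
Let k0 : 'I_n.+1 := Ordinal (leq_ltn_trans (leq_pred k1) (ltn_ord k1)).

Let k0S : k0.+1 = k1. Proof. by rewrite /= prednK // (valP k). Qed.
Let kS : (k : nat) = k0.+1. Proof. exact: esym k0S. Qed.
Let k01 : k1 != k0.
Proof. by rewrite -val_eqE /= -[X in X != _]k0S /= neq_ltn ltnSn orbT. Qed.

Lemma parabolic_transvection (Th' : {set ThetaM n.+1}) (i j : 'I_n.+1) (a : R) : i != j ->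
  (forall r : ThetaM n.+1, r \in Th' -> (j < r)%N -> (i < r)%N) ->
  parabolic Th' (slval (transvection i j a : G)).
Proof.
move=> ij H r rT i' j' jr ri; rewrite slval_transvection // !mxE.
rewrite -val_eqE /= gtn_eqF ?(leq_trans jr) // add0r.
case: eqVneq => [ei|_]; last by rewrite mulr0.
case: eqVneq => [ej|_]; last by rewrite mulr0.
by have := H r rT; rewrite -ej -ei jr ltnNge ri => /(_ isT).
Qed.

(** The passage from [j] to [i] is split at [k0] and [k1]: the outer transvections lie in the
    parabolic subgroup of [Th], the middle one in that of all indices but [k], and commutators
    compose them. *)
Lemma N_transvection (i j : 'I_n.+1) (a : R) : (k <= i)%N -> (j < k)%N ->
  (forall r : ThetaM n.+1, r \in (Th :\ k)%SET -> (j < r)%N -> (i < r)%N) ->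
  N (transvection i j a).
Proof.
move=> ki jk H.
have ij : i != j by rewrite -val_eqE /= gtn_eqF // (leq_trans jk).
have HT (r : ThetaM n.+1) : r \in Th -> (j < r)%N -> (i < r)%N \/ (r : nat) = k.
  move=> rT jr; have [->|rk] := eqVneq r k; first by right.
  by left; apply: H => //; rewrite !inE rk.
have N0 c : N (transvection k1 k0 c).
  apply: Nk; apply: parabolic_transvection => // r; rewrite !inE andbT => rk k0r.
  rewrite ltn_neqAle -k0S k0r andbT k0S.
  by apply: contra rk => /eqP/val_inj e; apply/eqP/val_inj.
have N0' c : N (transvection k1 j c).
  have [-> //|jk0] := eqVneq j k0.
  have Nj e : N (transvection k0 j e).
    apply: NTh; apply: parabolic_transvection; first by rewrite eq_sym.
    move=> r rT jr; case: (HT r rT jr) => [ir|->]; last by rewrite kS.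
    by rewrite (leq_trans _ ir) // ltnS ltnW // -kS.
  rewrite -[c]mulr1 (transvection_commutator _ _ k01) 1?eq_sym //.
    by do ![apply: NM => //].
  by rewrite -val_eqE /= ltn_eqF.
have [->|ik1] := eqVneq i k1; first exact: N0'.
have Ni e : N (transvection i k1 e).
  apply: NTh; apply: parabolic_transvection => // r rT k1r.
  case: (HT r rT (ltn_trans jk k1r)) => // e'.
  by move: k1r; rewrite e' ltnn.
rewrite -[a]mul1r (transvection_commutator _ _ ik1) //.
  by do ![apply: NM => //].
by rewrite -val_eqE /= gtn_eqF.
Qed.

(** [M] differs from 1 only in its lower left block. Such matrices multiply by adding their blocks,
    so [M] is the product of one transvection per entry. *)
Lemma N_unipotent (M : G) : parabolic (Th :\ k)%SET (slval M) ->
  (forall i j : 'I_n.+1, ~~ ((k <= i)%N && (j < k)%N) -> slval M i j = (i == j)%:R) ->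
  N M.
Proof.
move=> pM M1.
pose Tx (x : 'I_n.+1 * 'I_n.+1) : G := transvection x.1 x.2 (slval M x.1 x.2).
pose blk := [pred x : 'I_n.+1 * 'I_n.+1 | (k <= x.1)%N && (x.2 < k)%N].
have prodE s : uniq s -> all blk s -> forall i j,
    slval (foldr (fun x g => Tx x * g)%g (1%g : G) s) i j =
    if (i, j) \in s then slval M i j else (i == j)%:R.
  elim: s => [_ _ i j|x s IHs /= /andP[xs us] /andP[bx bs] i j]; first by rewrite mxE.
  have x12 : x.1 != x.2.
    by case/andP: bx => kx xk; rewrite -val_eqE /= gtn_eqF // (leq_trans xk).
  rewrite [slval _]/= mul_transvection // !IHs //.
  (* A column index of the block is smaller than [k], hence is not one of its row indices. *)
  have -> : (x.2, j) \in s = false.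
    apply/negP => /(allP bs) /andP[/= + _]; case/andP: bx => _ xk.
    by rewrite leqNgt xk.
  rewrite inE -pair_eqE /pair_eq /=.
  have [ex|nx] := eqVneq i x.1; last by rewrite addr0.
  have [ejx|njx] := eqVneq j x.2; last by rewrite /= mulr0 addr0.
  rewrite /= mulr1 ejx ex -surjective_pairing (negbTE xs) (negbTE x12).
  by rewrite add0r.
pose s := enum blk.
have sb x : (x \in s) = blk x by rewrite mem_enum.
have -> : M = foldr (fun x g => Tx x * g)%g (1%g : G) s.
  apply: val_inj; apply/matrixP => i j.
  rewrite -[RHS]/(slval _ i j) prodE ?enum_uniq //; last first.
    by apply/allP => x; rewrite sb.
  by rewrite sb /=; case: ifP => // /negbT/M1.
have : all blk s by apply/allP => x; rewrite sb.
elim: s {sb} => //= x s IHs /andP[/andP[kx xk] bs].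
apply: NM; last exact: IHs.
have [Mx0|Mx0] := eqVneq (slval M x.1 x.2) 0.
  by rewrite /Tx Mx0 transvection0.
apply: N_transvection => // r rT xr; rewrite ltnNge; apply: contra Mx0 => rx.
by rewrite (pM r rT).
Qed.

(** Erasing the lower left block [B] of [L] leaves a factor [L1] in the parabolic subgroup of [Th].
    The remaining factor is [1 + Gam], where [Gam] is supported in the same block. *)
Lemma N_unitlower (L : G) : unitlower (slval L) ->
  parabolic (Th :\ k)%SET (slval L) -> N L.
Proof.
move=> lL pL.
pose B : 'M[R]_n.+1 := \matrix_(i, j) if (k <= i)%N && (j < k)%N then slval L i j else 0.
pose L' := slval L - B.
have L'E i j : L' i j = if (k <= i)%N && (j < k)%N then 0 else slval L i j.
  by rewrite !mxE; case: ifP => _; rewrite ?subrr ?subr0.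
have lL' : unitlower L'.
  move=> i j ij; rewrite L'E lL //; case: ifP => // /andP[ki jk].
  by move: (leq_trans jk ki); rewrite ltnNge ij.
have /eqP dL' := unitlower_det lL'.
pose L1 : G := MkSL dL'.
have pL1 : parabolic Th (slval L1).
  move=> r rT i j jr ri; rewrite /= L'E.
  have [e|rk] := eqVneq r k; first by rewrite -e ri jr.
  by case: ifP => // _; rewrite (pL r) // !inE rk.
have pL1' : parabolic (Th :\ k)%SET (slval L1).
  by move=> r; rewrite inE => /andP[_ rT]; exact: pL1.
rewrite -(mulVKg L1 L); apply: NM; first exact: NTh.
apply: N_unipotent; first by apply: parabolicM => //; exact: parabolicV.
pose Gam := invmx L' *m B.
have eM : slval (L1^-1 * L)%g = 1%:M + Gam.
  have eL : slval L = L' + B by rewrite /L' subrK.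
  rewrite /Gam -[LHS]/(invmx L' *m slval L) [in LHS]eL mulmxDr mulVmx //.
  by rewrite unitmxE (eqP dL') unitr1.
have GamE : L' *m Gam = B by rewrite /Gam mulKVmx // unitmxE (eqP dL') unitr1.
move=> i j nblk; rewrite eM mxE [1%:M _ _]mxE.
suff -> : Gam i j = 0 by rewrite addr0.
have [ki|ik] := leqP k i.
  move: nblk; rewrite ki /= -leqNgt => kj.
  by rewrite mxE big1 // => l _; rewrite mxE ltnNge kj andbF mulr0.
apply: (@unitlower_solve _ _ L' _ k) => // l lk.
by rewrite GamE mxE leqNgt lk.
Qed.

(** [p] is a limit of products of a unit lower and an upper triangular matrix; the upper factor
    fixes [b0], and [A] is closed. *)
Lemma N_parabolicD1 (p : G) : parabolic (Th :\ k)%SET (slval p) -> N p.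
Proof.
move=> pp X AX; apply: cA => B nB.
have nU : nbhs p [set g | B (flag_act (X * g)%g (b0 TT))].
  have := @continuous_flag_actl R n.+1 TT (b0 TT) (X * p)%g B nB.
  by move=> /(@slmul_continuousl R n.+1 X p).
have [t [c [L [K [V [BK lL uV eK eX]]]]]] := perturb_LU 1%g nU.
have [uLK KL] := unitlower_upper_act TT uV eK eX.
exists (flag_act (X * K)%g (b0 TT)); split=> //.
rewrite flag_actM KL -flag_actM; apply: N_unitlower => //.
have -> : L = (K * (L^-1 * K)^-1)%g by rewrite invgM invgK mulgA mulgV mul1g.
apply: parabolicM; last by apply: parabolicV; exact: upper_parabolic.
(* Adding a multiple of 1 and rescaling a column keep the zero entries below the diagonal blocks. *)
move=> r rT i j jr ri; rewrite eK mul_mx_diag !mxE (pp r rT) // -val_eqE /=.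
by rewrite gtn_eqF ?(leq_trans jr) // mulr0 addr0 mul0r.
Qed.
End Gallery.

(** * Invariant cones *)

Section Cone.
Context {R : realType}.

Lemma mulmx_continuous m n p (A : 'M[R]_(m, n)) : continuous (fun x : 'M[R]_(n, p) => A *m x).
Proof.
move=> x; have FF := @nbhs_filter 'M[R]_(n, p) x.
by apply: (@cvg_mulmx _ _ _ FF _ _ _ (fun=> A) id); [exact: cvg_cst|exact: cvg_id].
Qed.

Definition convex_cone_over n (P W : set 'cV[R]_n) : Prop :=
  [/\ P `<=` W, closed W, (forall x y, W x -> W y -> W (x + y)), W 0
    & forall (t : R) x, 0 <= t -> W x -> W (t *: x)].

(** [W] is the smallest closed convex cone containing [P]. The linear form [f] is nonnegative on it,
    so [W] does not contain the opposite of a point of [P]. *)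
Lemma invariant_cone n (T : set 'M[R]_n) (P : set 'cV[R]_n) (f : 'cV[R]_n -> R) :
  P !=set0 -> (forall x, P x -> 0 < f x) -> continuous f ->
  (forall x y, f (x + y) = f x + f y) -> (forall t x, f (t *: x) = t * f x) ->
  (forall M x, T M -> P x -> P (M *m x)) ->
  exists W, is_cone W /\ forall M, T M -> [set M *m x | x in W] `<=` W.
Proof.
move=> [p Pp] Pf fc fD fZ TP.
pose W := [set x | forall W', convex_cone_over P W' -> W' x].
have WD x y : W x -> W y -> W (x + y).
  by move=> Wx Wy W' cW; have [_ _ D _ _] := cW; apply: D; [exact: Wx|exact: Wy].
have WZ (t : R) x : 0 <= t -> W x -> W (t *: x).
  by move=> t0 Wx W' cW; have [_ _ _ _ Z] := cW; apply: Z => //; exact: Wx.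
have Wp : W p by move=> W' [+ _ _ _ _]; apply.
have fW x : W x -> 0 <= f x.
  move=> /(_ [set y | 0 <= f y]); apply; split=> [y /Pf/ltW //||y z||t y t0] /=.
  - by have /continuous_closedP/(_ [set t : R | 0 <= t] (@closed_ge R 0)) := fc.
  - by move=> fy fz; rewrite fD addr_ge0.
  - by have := fZ 0 0; rewrite scale0r mul0r => ->.
  - by move=> fy; rewrite fZ mulr_ge0.
have f0 : f 0 = 0 by have := fZ 0 0; rewrite scale0r mul0r.
exists W; split.
  split.
  - rewrite (_ : W = \bigcap_(W' in convex_cone_over P) W').
      by apply: closed_bigI => W' [].
    by apply/seteqP; split.
  - move=> x y l /set_mem Wx /set_mem Wy; apply/mem_set.
    rewrite /conv /=; apply: WD; apply: WZ => //.
    by rewrite subr_ge0.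
  - by move=> W' [].
  - exact: WZ.
  - split=> e.
      have : W (- p) by rewrite e.
      move/fW; rewrite -scaleN1r fZ mulN1r oppr_ge0 leNgt.
      by rewrite Pf.
    have : W p by []. rewrite e => p0.
    by have := Pf p Pp; rewrite p0 f0 ltxx.
move=> M TM _ [x Wx <-] W' cW.
have [PW clW DW W0 ZW] := cW.
(* The preimage by [M] of a closed convex cone containing [P] is another one, because [M] maps [P]
   to itself. *)
apply: (Wx [set y | W' (M *m y)]); split=> [y Py|| y z||t y t0] /=.
- by apply: PW; exact: TP.
- by have /continuous_closedP/(_ W' clW) := @mulmx_continuous n n 1 M.
- by rewrite mulmxDr; exact: DW.
- by rewrite mulmx0.
- by rewrite -scalemxAr; exact: ZW.
Qed.

(** * Leading minors as linear forms on the exterior power *)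

Section ExteriorPower.
Context {n k : nat} (kn : (k <= n.+1)%N).
Notation G := (SL R n.+1).

(** The coordinate of [M (e_1 /\ ... /\ e_k)] along [e_1 /\ ... /\ e_k]; it vanishes when the image
    of [<e_1, ..., e_k>] meets [<e_(k+1), ..., e_(n+1)>] or [M] has a kernel there. *)
Definition leading_minor (M : 'M[R]_n.+1) : R :=
  \det (mxsub (widen_ord kn) (widen_ord kn) M).

Lemma leading_minor_eq0 (M : 'M[R]_n.+1) : leading_minor M = 0 ->
  exists c : 'cV[R]_n.+1, [/\ c != 0,
    forall i : 'I_n.+1, (k <= i)%N -> c i 0 = 0
    & forall i : 'I_n.+1, (i < k)%N -> (M *m c) i 0 = 0].
Proof.
rewrite /leading_minor -det_tr => /eqP/det0P[v v0 vM].
pose c : 'cV[R]_n.+1 := \col_i if insub (i : nat) is Some j then v 0 (j : 'I_k) else 0.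
have cE (j : 'I_k) : c (widen_ord kn j) 0 = v 0 j.
  by rewrite mxE /= (valK j).
have c0 (i : 'I_n.+1) : (k <= i)%N -> c i 0 = 0.
  by move=> ki; rewrite mxE insubF // ltnNge ki.
exists c; split=> // [|i ik].
  apply: contraNneq v0 => c00; apply/eqP/rowP => j.
  by rewrite -cE c00 !mxE.
have /rowP/(_ (Ordinal ik)) := vM; rewrite !mxE => e; rewrite -[RHS]e.
rewrite (bigID (fun j : 'I_n.+1 => (j < k)%N)) /= [X in _ + X]big1 ?addr0.
  rewrite (big_ord_narrow kn); apply: eq_bigr => j _.
  by rewrite cE !mxE mulrC; congr (_ * M _ _); exact: val_inj.
by move=> j; rewrite -leqNgt => kj; rewrite c0 // mulr0.
Qed.

Lemma leading_index : exists a : 'I_#|{: incr n.+1 k}|, forall i, incr_val a i = widen_ord kn i.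
Proof.
pose t := [tuple widen_ord kn i | i < k].
have st : sorted ltn (map val t).
  rewrite -map_comp (_ : map _ _ = iota 0 k); first exact: iota_ltn_sorted.
  by rewrite -[RHS]val_enum_ord; apply: eq_map.
exists (enum_rank (exist _ t st : incr n.+1 k)) => i.
by rewrite /incr_val enum_rankK /= tnth_mktuple.
Qed.

(** The minor is a continuous function on the connected set [S] without zeros, so its sign is
    constant; it is a linear form evaluated along the orbit of the decomposable vector [v]. *)
Lemma ext_cone (S : set G) (A B : G) :
  is_semigroup S -> connected S -> S !=set0 ->
  (forall g, S g -> leading_minor (slval A *m slval g *m slval B) != 0) ->
  exists W : set (ext R n.+1 k), is_cone W /\ ext_invariant S W.
Proof.
move=> sS cS [g0 Sg0] H.
have [a aE] := leading_index.
pose v : ext R n.+1 k := wedge (colsub (widen_ord kn) (slval B)).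
pose f (x : ext R n.+1 k) := (ext_mx k (slval A) *m x) a 0.
pose F (g : G) := f (ext_mx k (slval g) *m v).
have FE g : F g = leading_minor (slval A *m slval g *m slval B).
  rewrite /F /f /v !ext_mx_wedge mxE /leading_minor; congr (\det _).
  apply/matrixP => i j; rewrite [LHS]mxE [RHS]mxE aE mulmxA [LHS]mxE [RHS]mxE.
  by apply: eq_bigr => l _; rewrite [colsub _ _ _ _]mxE.
have Fc : continuous F.
  move=> g; rewrite /continuous_at FE (eq_cvg _ _ FE) /leading_minor.
  have c : (fun h : G => slval A *m slval h *m slval B) @ nbhs g --> slval A *m slval g *m slval B.
    have FF := @nbhs_filter G g.
    apply: (@cvg_mulmx _ _ _ FF _ _ _ (fun h : G => slval A *m slval h) (fun=> slval B));
      last exact: cvg_cst.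
    by apply: (@cvg_mulmx _ _ _ FF _ _ _ (fun=> slval A) (@slval R n.+1));
      [exact: cvg_cst|exact: slval_continuous].
  have FF := @nbhs_filter G g.
  apply: (@cvg_det _ _ _ FF); apply/cvg_mxP => i j.
  move/cvg_mxP : c => c; rewrite mxE.
  by under eq_cvg do rewrite mxE; exact: c.
have itv : is_interval (F @` S).
  apply/connected_intervalP; apply: connected_continuous_connected => //.
  exact: continuous_subspaceT.
have nF0 : ~ (F @` S) 0.
  by case=> g Sg e; have := H g Sg; rewrite -FE e eqxx.
have Fpos g : S g -> 0 < Num.sg (F g0) * F g.
  move=> Sg; have Fg : (F @` S) (F g) by exists g.
  have Fg0 : (F @` S) (F g0) by exists g0.
  case: (ltgtP 0 (F g0)) => F0.
  - rewrite gtr0_sg // mul1r ltNge; apply/negP => Fle; apply: nF0.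
    by apply: (itv _ _ Fg Fg0); rewrite Fle ltW.
  - rewrite ltr0_sg // mulN1r oppr_gt0 ltNge; apply/negP => Fle; apply: nF0.
    by apply: (itv _ _ Fg0 Fg); rewrite Fle ltW.
  - by case: nF0; rewrite F0.
pose e := Num.sg (F g0).
(* The constant sign [e] makes [f] positive on the generators. *)
have [||||||W [cW iW]] := @invariant_cone _ [set ext_mx k (slval g) | g in S]
  [set e *: (ext_mx k (slval g) *m v) | g in S] f.
- by exists (e *: (ext_mx k (slval g0) *m v)), g0.
- by move=> _ [g Sg <-]; rewrite /f -scalemxAr mxE; exact: Fpos.
- move=> x; have := @mulmx_continuous _ _ 1 (ext_mx k (slval A)) x.
  by move=> /cvg_mxP; apply.
- by move=> x y; rewrite /f mulmxDr mxE.
- by move=> t x; rewrite /f -scalemxAr mxE.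
- move=> _ _ [g Sg <-] [h Sh <-]; exists (g * h)%g; first exact: sS.
  by rewrite -scalemxAr /v !ext_mx_wedge mulmxA.
by exists W; split=> // g Sg; apply: iW; exists g.
Qed.
End ExteriorPower.
End Cone.

(** * The alternative: an invariant cone, or a flag type without [k] *)

Theorem theorem6 (R : realType) (d : nat) (hd : (2 <= d)%N) (S : set (SL R d))
    (Ssemigroup : is_semigroup S) (Sconnected : connected S)
    (Sinterior : interior S !=set0) (k : ThetaM d)
    (hk : k \in flag_type S) :
  exists W : set (ext R d k), is_cone W /\ ext_invariant S W.
Proof.
case: d hd S Ssemigroup Sconnected Sinterior k hk => // n _ S sS cS S0 k kT.
have [h [P [lam [Sh lamd hP]]]] := semigroup_regular sS S0.
have kn : (k <= n.+1)%N by rewrite ltnW // ltn_ord.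
have [deg|] := pselect (degenerate S k); last first.
  move=> /existsNP[A /existsNP[B nAB]].
  have [g0 Sg0] := S0.
  apply: (@ext_cone R n k kn S A B) => //; first by exists g0; exact: interior_subset.
  move=> g Sg; apply/negP => /eqP/leading_minor_eq0[c [c0 ck cM]].
  by apply: nAB; exists g, c.
have satE (Th : {set ThetaM n.+1}) := preimage_saturated sS S0 Sh lamd hP Th.
(* The full set of indices qualifies, so a minimal set exists and [flag_type] is not a default
   value. *)
have satT : saturated S P [set: ThetaM n.+1]%SET.
  by move=> X p CX /stab_std_flag pp; rewrite flag_actM pp.
have ft : is_flag_type S (flag_type S).
  have ex : exists Th, is_flag_type S Th.
    have [|Th mTh] := @ex_minset _ (fun Th' : {set ThetaM n.+1} =>
      `[< flag_proj Th' @^-1` invariant_control_set S (Th := Th') =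
          invariant_control_set S (Th := [set: ThetaM n.+1]%SET) >]).
      by exists [set: ThetaM n.+1]%SET; apply/asboolP/satE.
    by exists Th.
  exact: (xgetPex _ ex).
have /minsetP[/asboolP/satE satTh minTh] := ft.
(* In the degenerate case, stability by the parabolic subgroups of [flag_type S] and of all indices
   but [k] gives that of [flag_type S :\ k]; minimality then contradicts [kT]. *)
have : (flag_type S :\ k)%SET = flag_type S.
  apply: minTh; last exact: subD1set.
  apply/asboolP/satE => X p CX pp.
  apply: (@N_parabolicD1 R n _ _ (flag_type S) k) pp X CX.
  - exact: closed_closure.
  - by move=> q pq Y CY; exact: satTh.
  - by move=> q pq Y CY; apply: (saturated_degenerate sS S0 Sh lamd hP deg).
by move=> /setP/(_ k); rewrite !inE eqxx kT.
Qed.
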